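(* (Liouville's theorem) If $u\in\widetilde{\mathcal G}_H(\widetilde{\mathbb C})$ is bounded, i.e. there exists $C\in\widetilde{\mathbb R}$ such that $|u(\tilde z)|\le C$ for each $\tilde z\in\widetilde{\mathbb C}$, then $u$ is a generalized constant, i.e. there is $c\in\widetilde{\mathbb C}$ with $u=c$ in $\widetilde{\mathcal G}(\widetilde{\mathbb C})$.
   Context: Nets are indexed by $\varepsilon\in(0,1)$; ''for small $\varepsilon$'' means for all $\varepsilon\le\varepsilon_0$ for some $\varepsilon_0\in(0,1)$; $0\in\mathbb N$. A net $(z_\varepsilon)_\varepsilon$ in $\mathbb C$ is moderate ($\in\mathcal M_{\mathbb C}$) if there is $N\in\mathbb N$ with $|z_\varepsilon|\le\varepsilon^{-N}$ for small $\varepsilon$, and negligible ($\in\mathcal N_{\mathbb C}$) if for each $m\in\mathbb N$, $|z_\varepsilon|\le\varepsilon^m$ for small $\varepsilon$. $\widetilde{\mathbb C}=\mathcal M_{\mathbb C}/\mathcal N_{\mathbb C}$, and $\widetilde{\mathbb R}$ is defined in the same way with real nets; $[(z_\varepsilon)_\varepsilon]$ is the class of $(z_\varepsilon)_\varepsilon$, and $|[(z_\varepsilon)_\varepsilon]|=[(|z_\varepsilon|)_\varepsilon]\in\widetilde{\mathbb R}$. For $a,b\in\widetilde{\mathbb R}$, $a\le b$ means there are representatives with $a_\varepsilon\le b_\varepsilon$ for small $\varepsilon$. Identify $\mathbb C$ with $\mathbb R^2$. For $\emptyset\ne A\subseteq\widetilde{\mathbb C}$, $\widetilde{\mathcal G}(A)=\mathcal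 E_M(A)/\mathcal N(A)$, where $\mathcal E_M(A)$ (resp. $\mathcal N(A)$) is the set of nets $(u_\varepsilon)_\varepsilon$ of $C^\infty$ functions $\mathbb R^2\to\mathbb C$ such that for every $\alpha\in\mathbb N^2$ and every representative $(x_\varepsilon)_\varepsilon$ of every element of $A$, $(\partial^\alpha u_\varepsilon(x_\varepsilon))_\varepsilon\in\mathcal M_{\mathbb C}$ (resp. $\in\mathcal N_{\mathbb C}$). Operations and derivatives are $\varepsilon$-wise. Point values: $u(\tilde x)=[(u_\varepsilon(x_\varepsilon))_\varepsilon]\in\widetilde{\mathbb C}$ for $\tilde x=[(x_\varepsilon)_\varepsilon]\in A$ (well-defined). A constant $c=[(c_\varepsilon)_\varepsilon]\in\widetilde{\mathbb C}$ is viewed as the element of $\widetilde{\mathcal G}(A)$ represented by the constant functions $c_\varepsilon$. $\widetilde{\mathcal G}_H(A)=\{u\in\widetilde{\mathcal G}(A):\bar\partial u=\frac12(\partial_x+i\partial_y)u=0\}$, for $A$ open in the sharp topology (in particular for $A=\widetilde{\mathbb C}$). *)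

(* Defs.v *)
From Stdlib Require Import Reals Lra Lia Arith.
From Stdlib Require Import ClassicalEpsilon ProofIrrelevance.
From Stdlib Require Import FunctionalExtensionality PropExtensionality IndefiniteDescription.
From Coquelicot Require Import Coquelicot.

Set Implicit Arguments.
Unset Strict Implicit.
Open Scope R_scope.

Record index := Index { ival :> R; ival_gt0 : 0 < ival; ival_lt1 : ival < 1 }.

Definition net (X : Type) := index -> X.

Definition for_small (P : index -> Prop) : Prop :=
  exists e0 : index, forall e : index, e <= e0 -> P e.

(* K is R_AbsRing or C_AbsRing; [abs] is then [Rabs] or [Cmod]. *)
Definition moderate (K : AbsRing) (z : net K) : Prop :=
  exists N : nat, for_small (fun e => abs (z e) <= / (e ^ N)).

Definition negligible (K : AbsRing) (z : net K) : Prop :=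
  forall m : nat, for_small (fun e => abs (z e) <= e ^ m).

Lemma for_small_and (P Q : index -> Prop) :
  for_small P -> for_small Q -> for_small (fun e => P e /\ Q e).
Proof.
intros [a Ha] [b Hb].
destruct (Rle_dec a b) as [H|H].
- exists a; intros e He; split; [apply Ha | apply Hb]; lra.
- exists b; intros e He; split; [apply Ha | apply Hb]; lra.
Qed.

Lemma for_small_imp (P Q : index -> Prop) :
  (forall e, P e -> Q e) -> for_small P -> for_small Q.
Proof. intros H [a Ha]; exists a; auto. Qed.

Lemma for_small_le (r : R) : 0 < r -> for_small (fun e => e <= r).
Proof.
intros Hr.
assert (H0 : 0 < Rmin r (/ 2)) by (apply Rmin_glb_lt; lra).
assert (H1 : Rmin r (/ 2) < 1) by (generalize (Rmin_r r (/ 2)); lra).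
exists (Index H0 H1); simpl; intros e He.
generalize (Rmin_l r (/ 2)); lra.
Qed.

Lemma pow_index_le (e : index) (m n : nat) : (m <= n)%nat -> e ^ n <= e ^ m.
Proof.
intros H; replace n with (m + (n - m))%nat by lia; rewrite pow_add.
generalize (ival_gt0 e) (ival_lt1 e); intros H0 H1.
assert (0 < e ^ m) by now apply pow_lt.
assert (e ^ (n - m) <= 1).
{ rewrite <- (pow1 (n - m)); apply pow_incr; lra. }
nra.
Qed.

Lemma negligible_bound (K : AbsRing) (z : net K) (a b : net R) :
  (forall m, for_small (fun e => a e <= e ^ m)) ->
  (forall m, for_small (fun e => b e <= e ^ m)) ->
  for_small (fun e => abs (z e) <= a e + b e) -> negligible z.
Proof.
intros Ha Hb Hz m.
assert (H2 : 0 < / 2) by lra.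
generalize (for_small_and (for_small_and (Ha (S m)) (Hb (S m)))
              (for_small_and Hz (for_small_le H2))).
apply for_small_imp; intros e [[H H0] [H1 H3]].
simpl in H, H0.
assert (0 < e ^ m) by apply pow_lt, ival_gt0.
nra.
Qed.

Lemma moderate_bound (K : AbsRing) (z : net K) (a b : net R) (N M : nat) :
  for_small (fun e => a e <= / (e ^ N)) ->
  for_small (fun e => b e <= / (e ^ M)) ->
  for_small (fun e => abs (z e) <= a e + b e) -> moderate z.
Proof.
intros Ha Hb Hz; exists (S (N + M)).
assert (H2 : 0 < / 2) by lra.
generalize (for_small_and (for_small_and Ha Hb)
              (for_small_and Hz (for_small_le H2))).
apply for_small_imp; intros e [[H H0] [H1 H3]].
generalize (ival_gt0 e) (ival_lt1 e); intros E0 E1.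
assert (HN : e ^ (N + M) <= e ^ N) by (apply pow_index_le; lia).
assert (HM : e ^ (N + M) <= e ^ M) by (apply pow_index_le; lia).
assert (P : 0 < e ^ (N + M)) by now apply pow_lt.
apply Rinv_le_contravar in HN; [|assumption].
apply Rinv_le_contravar in HM; [|assumption].
simpl; rewrite Rinv_mult.
assert (2 <= / e).
{ rewrite <- (Rinv_inv 2); apply Rinv_le_contravar; lra. }
assert (0 < / e ^ (N + M)) by now apply Rinv_0_lt_compat.
nra.
Qed.

(* The quotient of {t | M t} by E; its elements are the equivalence classes,
   represented as predicates on T. *)
Record quotient (T : Type) (M : T -> Prop) (E : T -> T -> Prop) := Quotient {
  represents : T -> Prop;
  represents_class :
    exists t, M t /\ represents = (fun s => M s /\ E s t)
}.

Arguments represents {T M E} q t.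

Definition class (T : Type) (M : T -> Prop) (E : T -> T -> Prop)
    (t : T) (Ht : M t) : quotient M E :=
  Quotient (ex_intro _ t (conj Ht eq_refl)).

Arguments class {T M} E {t} Ht.

Definition is_equiv (T : Type) (M : T -> Prop) (E : T -> T -> Prop) : Prop :=
  (forall t, M t -> E t t) /\
  (forall s t, M s -> M t -> E s t -> E t s) /\
  (forall r s t, M r -> M s -> M t -> E r s -> E s t -> E r t).

Section Quotient.
Context (T : Type) (M : T -> Prop) (E : T -> T -> Prop).
Implicit Types q : quotient M E.

Lemma represents_dom q t : represents q t -> M t.
Proof. destruct q as [P [s [Hs ->]]]; simpl; tauto. Qed.

Lemma quotient_ext q1 q2 :
  (forall t, represents q1 t <-> represents q2 t) -> q1 = q2.
Proof.
destruct q1 as [P HP], q2 as [Q HQ]; simpl; intros H.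
assert (PQ : P = Q).
{ apply functional_extensionality; intros t.
  now apply propositional_extensionality. }
subst Q; f_equal; apply proof_irrelevance.
Qed.

Context (HE : is_equiv M E).

Lemma represents_self t (Ht : M t) : represents (class E Ht) t.
Proof. simpl; split; [assumption | now apply (proj1 HE)]. Qed.

Lemma represents_ex q : exists t, represents q t.
Proof.
destruct q as [P [t [Ht ->]]]; simpl; exists t; split; [exact Ht | now apply (proj1 HE)].
Qed.

Lemma represents_equiv q s t : represents q s -> represents q t -> E s t.
Proof.
destruct q as [P [r [Hr ->]]]; simpl; intros [Ms Hs] [Mt Ht].
destruct HE as (_ & Hsym & Htrans).
apply (Htrans s r t); auto.
Qed.

Lemma class_eq s t (Hs : M s) (Ht : M t) :
  class E Hs = class E Ht <-> E s t.
Proof.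
destruct HE as (Hrefl & Hsym & Htrans); split.
- intros H; apply (represents_equiv (q := class E Ht)).
  + rewrite <- H; now apply represents_self.
  + now apply represents_self.
- intros H; apply quotient_ext; intros r; simpl; split; intros [Hr Hrs];
    (split; [assumption|]).
  + now apply (Htrans r s t).
  + apply (Htrans r t s); auto.
Qed.

Lemma classP q t (H : represents q t) : q = class E (represents_dom H).
Proof.
destruct HE as (Hrefl & Hsym & Htrans).
apply quotient_ext; intros r; split.
- intros Hr; split; [now apply (represents_dom Hr) |].
  now apply (represents_equiv Hr).
- revert H; destruct q as [P [s [Hs ->]]]; intros H; simpl in *.
  intros [Mr Hr]; split; [assumption|].
  now apply (Htrans r t s).
Qed.

Lemma represents_closed q s t :
  represents q t -> M s -> E s t -> represents q s.
Proof.
destruct HE as (_ & _ & Htrans).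
destruct q as [P [r [Hr ->]]]; simpl; intros [Mt Ht] Ms Hst.
split; [assumption | now apply (Htrans s t r)].
Qed.

End Quotient.

(* Maps out of a quotient are defined on a chosen representative; each such
   definition is followed by a lemma showing that the choice is irrelevant. *)
Definition repr (T : Type) (M : T -> Prop) (E : T -> T -> Prop)
    (HE : is_equiv M E) (q : quotient M E) : T :=
  proj1_sig (constructive_indefinite_description _ (represents_ex HE q)).

Lemma reprP (T : Type) (M : T -> Prop) (E : T -> T -> Prop)
    (HE : is_equiv M E) (q : quotient M E) : represents q (repr HE q).
Proof.
exact (proj2_sig (constructive_indefinite_description _ (represents_ex HE q))).
Qed.

Lemma repr_dom (T : Type) (M : T -> Prop) (E : T -> T -> Prop)
    (HE : is_equiv M E) (q : quotient M E) : M (repr HE q).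
Proof. exact (represents_dom (reprP HE q)). Qed.

Definition net_equiv (K : AbsRing) (x y : net K) : Prop :=
  negligible (fun e => minus (x e) (y e)).

Lemma negligible_le (K L : AbsRing) (x : net K) (y : net L) :
  (forall e, abs (x e) <= abs (y e)) -> negligible y -> negligible x.
Proof.
intros H Hy m; generalize (Hy m); apply for_small_imp; intros e He.
generalize (H e); lra.
Qed.

Lemma moderate_le (K L : AbsRing) (x : net K) (y : net L) :
  (forall e, abs (x e) <= abs (y e)) -> moderate y -> moderate x.
Proof.
intros H [N Hy]; exists N; revert Hy; apply for_small_imp; intros e He.
generalize (H e); lra.
Qed.

Lemma negligible_plus (K : AbsRing) (x y : net K) :
  negligible x -> negligible y -> negligible (fun e => plus (x e) (y e)).
Proof.
intros Hx Hy; apply (negligible_bound Hx Hy).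
assert (H : 0 < 1) by lra.
generalize (for_small_le H); apply for_small_imp; intros e _.
apply abs_triangle.
Qed.

Lemma moderate_plus (K : AbsRing) (x y : net K) :
  moderate x -> moderate y -> moderate (fun e => plus (x e) (y e)).
Proof.
intros [N Hx] [M Hy]; apply (moderate_bound Hx Hy).
assert (H : 0 < 1) by lra.
generalize (for_small_le H); apply for_small_imp; intros e _.
apply abs_triangle.
Qed.

Lemma net_equiv_is_equiv (K : AbsRing) :
  is_equiv (@moderate K) (@net_equiv K).
Proof.
split; [|split].
- intros x _ m.
  assert (H : 0 < 1) by lra.
  generalize (for_small_le H); apply for_small_imp; intros e _.
  rewrite (minus_eq_zero (x e)).
  apply Rle_trans with 0; [right; apply abs_zero | left; apply pow_lt, ival_gt0].
- intros x y _ _ H; revert H; apply negligible_le; intros e.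
  rewrite <- opp_minus, abs_opp; lra.
- intros x y z _ _ _ Hxy Hyz.
  generalize (negligible_plus Hxy Hyz); apply negligible_le; intros e.
  right; f_equal; apply (minus_trans (y e)).
Qed.

Definition gnum (K : AbsRing) := quotient (@moderate K) (@net_equiv K).

Definition Rtilde := gnum R_AbsRing.
Definition Ctilde := gnum C_AbsRing.

Lemma moderate_abs (K : AbsRing) (z : net K) :
  moderate z -> moderate (K := R_AbsRing) (fun e => abs (z e)).
Proof.
apply moderate_le; intros e.
change (Rabs (abs (z e)) <= abs (z e)).
rewrite Rabs_pos_eq; [lra | apply abs_ge_0].
Qed.

Definition gabs (z : Ctilde) : Rtilde :=
  class (@net_equiv R_AbsRing)
    (moderate_abs (repr_dom (net_equiv_is_equiv C_AbsRing) z)).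

Lemma abs_minus_abs (K : AbsRing) (x y : K) :
  Rabs (abs x - abs y) <= abs (minus x y).
Proof.
assert (T : forall a b : K, abs a <= abs (minus a b) + abs b).
{ intros a b; assert (E : plus (minus a b) b = a).
  { unfold minus; rewrite <- plus_assoc; rewrite (plus_opp_l b).
    apply plus_zero_r. }
  rewrite <- E at 1; apply abs_triangle. }
assert (S : abs (minus y x) = abs (minus x y)).
{ rewrite <- (opp_minus x y); apply abs_opp. }
generalize (T x y) (T y x); rewrite S; intros H1 H2.
apply Rabs_le; lra.
Qed.

Lemma gabsE (z : net C_AbsRing) (Hz : moderate z) :
  gabs (class (@net_equiv C_AbsRing) Hz) =
  class (@net_equiv R_AbsRing) (moderate_abs Hz).
Proof.
apply class_eq; [apply net_equiv_is_equiv|].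
assert (H := represents_equiv (net_equiv_is_equiv C_AbsRing)
  (reprP (net_equiv_is_equiv C_AbsRing) (class (@net_equiv C_AbsRing) Hz))
  (represents_self (net_equiv_is_equiv C_AbsRing) Hz)).
revert H; apply negligible_le; intros e; apply abs_minus_abs.
Qed.

Definition gle (a b : Rtilde) : Prop :=
  exists x y : net R,
    represents a x /\ represents b y /\ for_small (fun e => x e <= y e).

(* Smooth functions R^2 -> C, with C = R * R identified with R^2 *)

Definition dx (f : C -> C) : C -> C := fun z =>
  (Derive (fun t => Re (f (t, Im z))) (Re z),
   Derive (fun t => Im (f (t, Im z))) (Re z)).

Definition dy (f : C -> C) : C -> C := fun z =>
  (Derive (fun t => Re (f (Re z, t))) (Im z),
   Derive (fun t => Im (f (Re z, t))) (Im z)).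

(* Needed because [Derive] is total. *)
Definition has_partials (f : C -> C) : Prop := forall z : C,
  ex_derive (fun t => Re (f (t, Im z))) (Re z) /\
  ex_derive (fun t => Im (f (t, Im z))) (Re z) /\
  ex_derive (fun t => Re (f (Re z, t))) (Im z) /\
  ex_derive (fun t => Im (f (Re z, t))) (Im z).

Fixpoint Ck (k : nat) (f : C -> C) : Prop :=
  (forall z : C, continuous f z) /\
  match k with
  | O => True
  | S k' => has_partials f /\ Ck k' (dx f) /\ Ck k' (dy f)
  end.

Definition smooth (f : C -> C) : Prop := forall k, Ck k f.

Definition partial (a b : nat) (f : C -> C) : C -> C :=
  Nat.iter a dx (Nat.iter b dy f).

Lemma continuous_Re (f : C -> C) (z : C) :
  continuous f z -> continuous (fun w => Re (f w)) z.
Proof.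
intros H; apply (continuous_comp f (fst : C -> R)); [assumption|].
destruct (f z); apply continuous_fst.
Qed.

Lemma continuous_Im (f : C -> C) (z : C) :
  continuous f z -> continuous (fun w => Im (f w)) z.
Proof.
intros H; apply (continuous_comp f (snd : C -> R)); [assumption|].
destruct (f z); apply continuous_snd.
Qed.

Lemma continuous_C (f : C -> C) (z : C) :
  continuous (fun w => Re (f w)) z -> continuous (fun w => Im (f w)) z ->
  continuous f z.
Proof.
intros H1 H2; apply continuous_ext with (fun w => (Re (f w), Im (f w))).
{ intros w; unfold Re, Im; now destruct (f w). }
apply (continuous_comp_2 (X := C_UniformSpace) _ _ (fun a b : R => (a, b)));
  try assumption.
apply continuous_ext with (fun p : R * R => p); [now intros [a b]|].
apply continuous_id.
Qed.

Lemma smooth_continuous f z : smooth f -> continuous f z.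
Proof. intros H; apply (H 0%nat). Qed.

Lemma smooth_has_partials f : smooth f -> has_partials f.
Proof. intros H; apply (H 1%nat). Qed.

Lemma smooth_dx f : smooth f -> smooth (dx f).
Proof. intros H k; apply (H (S k)). Qed.

Lemma smooth_dy f : smooth f -> smooth (dy f).
Proof. intros H k; apply (H (S k)). Qed.

Lemma smooth_partial a b f : smooth f -> smooth (partial a b f).
Proof.
intros H; unfold partial; induction a as [|a IHa]; simpl.
- induction b as [|b IHb]; simpl; [assumption | now apply smooth_dy].
- now apply smooth_dx.
Qed.

Lemma dx_plus f g : has_partials f -> has_partials g ->
  dx (fun z => f z + g z)%C = (fun z => dx f z + dx g z)%C.
Proof.
intros Hf Hg; apply functional_extensionality; intros z.
destruct (Hf z) as (f1 & f2 & _), (Hg z) as (g1 & g2 & _).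
unfold dx, Cplus; simpl; f_equal; now apply Derive_plus.
Qed.

Lemma dy_plus f g : has_partials f -> has_partials g ->
  dy (fun z => f z + g z)%C = (fun z => dy f z + dy g z)%C.
Proof.
intros Hf Hg; apply functional_extensionality; intros z.
destruct (Hf z) as (_ & _ & f1 & f2), (Hg z) as (_ & _ & g1 & g2).
unfold dy, Cplus; simpl; f_equal; now apply Derive_plus.
Qed.

Lemma has_partials_plus f g : has_partials f -> has_partials g ->
  has_partials (fun z => f z + g z)%C.
Proof.
intros Hf Hg z.
destruct (Hf z) as (f1 & f2 & f3 & f4), (Hg z) as (g1 & g2 & g3 & g4).
repeat split; simpl; now apply (ex_derive_plus (V := R_NormedModule)).
Qed.

Lemma Ck_plus k f g : Ck k f -> Ck k g -> Ck k (fun z => f z + g z)%C.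
Proof.
revert f g; induction k as [|k IH]; simpl; intros f g [cf Hf] [cg Hg]; split.
1, 3: intros z; now apply (continuous_plus (V := C_R_NormedModule)).
- exact I.
- destruct Hf as (pf & f1 & f2), Hg as (pg & g1 & g2).
  split; [now apply has_partials_plus|].
  rewrite dx_plus, dy_plus by assumption; auto.
Qed.

Lemma smooth_plus f g : smooth f -> smooth g -> smooth (fun z => f z + g z)%C.
Proof. intros Hf Hg k; now apply Ck_plus. Qed.

Lemma partial_plus a b f g : smooth f -> smooth g ->
  partial a b (fun z => f z + g z)%C =
  (fun z => partial a b f z + partial a b g z)%C.
Proof.
intros Hf Hg; induction a as [|a IHa].
- induction b as [|b IHb]; [reflexivity|].
  change (dy (partial 0 b (fun z => f z + g z)%C) =
    (fun z => dy (partial 0 b f) z + dy (partial 0 b g) z)%C).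
  rewrite IHb; apply dy_plus; apply smooth_has_partials; now apply smooth_partial.
- change (dx (partial a b (fun z => f z + g z)%C) =
    (fun z => dx (partial a b f) z + dx (partial a b g) z)%C).
  rewrite IHa; apply dx_plus; apply smooth_has_partials; now apply smooth_partial.
Qed.

Lemma Derive_lin (f g : R -> R) (p q x : R) :
  ex_derive f x -> ex_derive g x ->
  ex_derive (fun t => p * f t + q * g t) x /\
  Derive (fun t => p * f t + q * g t) x = p * Derive f x + q * Derive g x.
Proof.
intros Hf Hg.
assert (H : is_derive (fun t => p * f t + q * g t) x
              (p * Derive f x + q * Derive g x)).
{ apply (is_derive_plus (V := R_NormedModule));
    apply is_derive_scal; now apply Derive_correct. }
split; [now exists (p * Derive f x + q * Derive g x) | now apply is_derive_unique].
Qed.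

Lemma Derive_lin_minus (f g : R -> R) (p q x : R) :
  ex_derive f x -> ex_derive g x ->
  ex_derive (fun t => p * f t - q * g t) x /\
  Derive (fun t => p * f t - q * g t) x = p * Derive f x - q * Derive g x.
Proof.
intros Hf Hg; destruct (Derive_lin p (- q) Hf Hg) as [H1 H2].
split.
- apply (ex_derive_ext (fun t => p * f t + - q * g t)); [|exact H1].
  intros t; simpl; ring.
- rewrite <- (Derive_ext (fun t => p * f t + - q * g t)); [|intros t; ring].
  rewrite H2; ring.
Qed.

Lemma has_partials_scal c f :
  has_partials f -> has_partials (fun z => c * f z)%C.
Proof.
intros Hf z; destruct (Hf z) as (f1 & f2 & f3 & f4).
repeat split.
- exact (proj1 (Derive_lin_minus (fst c) (snd c) f1 f2)).
- exact (proj1 (Derive_lin (fst c) (snd c) f2 f1)).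
- exact (proj1 (Derive_lin_minus (fst c) (snd c) f3 f4)).
- exact (proj1 (Derive_lin (fst c) (snd c) f4 f3)).
Qed.

Lemma dx_scal c f : has_partials f ->
  dx (fun z => c * f z)%C = (fun z => c * dx f z)%C.
Proof.
intros Hf; apply functional_extensionality; intros z.
destruct (Hf z) as (f1 & f2 & f3 & f4).
apply injective_projections.
- exact (proj2 (Derive_lin_minus (fst c) (snd c) f1 f2)).
- exact (proj2 (Derive_lin (fst c) (snd c) f2 f1)).
Qed.

Lemma dy_scal c f : has_partials f ->
  dy (fun z => c * f z)%C = (fun z => c * dy f z)%C.
Proof.
intros Hf; apply functional_extensionality; intros z.
destruct (Hf z) as (f1 & f2 & f3 & f4).
apply injective_projections.
- exact (proj2 (Derive_lin_minus (fst c) (snd c) f3 f4)).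
- exact (proj2 (Derive_lin (fst c) (snd c) f4 f3)).
Qed.

Lemma Ck_scal k c f : Ck k f -> Ck k (fun z => c * f z)%C.
Proof.
revert f; induction k as [|k IH]; simpl; intros f [cf Hf]; split.
1, 3: intros z; assert (H1 := continuous_Re (cf z));
  assert (H2 := continuous_Im (cf z)); apply continuous_C;
  [ apply (continuous_minus (V := R_NormedModule)
      (fun w => fst c * Re (f w)) (fun w => snd c * Im (f w)))
  | apply (continuous_plus (V := R_NormedModule)
      (fun w => fst c * Im (f w)) (fun w => snd c * Re (f w))) ];
  now apply (continuous_scal_r (V := R_NormedModule)).
- exact I.
- destruct Hf as (pf & f1 & f2).
  split; [now apply has_partials_scal|].
  rewrite dx_scal, dy_scal by assumption; auto.
Qed.

Lemma smooth_scal c f : smooth f -> smooth (fun z => c * f z)%C.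
Proof. intros Hf k; now apply Ck_scal. Qed.

Lemma partial_scal a b c f : smooth f ->
  partial a b (fun z => c * f z)%C = (fun z => c * partial a b f z)%C.
Proof.
intros Hf; induction a as [|a IHa].
- induction b as [|b IHb]; [reflexivity|].
  change (dy (partial 0 b (fun z => c * f z)%C) =
    (fun z => c * dy (partial 0 b f) z)%C).
  rewrite IHb; apply dy_scal, smooth_has_partials; now apply smooth_partial.
- change (dx (partial a b (fun z => c * f z)%C) =
    (fun z => c * dx (partial a b f) z)%C).
  rewrite IHa; apply dx_scal, smooth_has_partials; now apply smooth_partial.
Qed.

Lemma Cminus_scal (x y : C) : (x - y = x + RtoC (-1) * y)%C.
Proof. apply injective_projections; simpl; ring. Qed.

Lemma minus_fun_scal (f g : C -> C) :
  (fun z => f z - g z)%C = (fun z => f z + RtoC (-1) * g z)%C.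
Proof. apply functional_extensionality; intros z; apply Cminus_scal. Qed.

Lemma smooth_minus f g : smooth f -> smooth g -> smooth (fun z => f z - g z)%C.
Proof.
intros Hf Hg; rewrite minus_fun_scal.
now apply smooth_plus; [|apply smooth_scal].
Qed.

Lemma partial_minus a b f g : smooth f -> smooth g ->
  partial a b (fun z => f z - g z)%C =
  (fun z => partial a b f z - partial a b g z)%C.
Proof.
intros Hf Hg; rewrite minus_fun_scal, partial_plus;
  [| assumption | now apply smooth_scal].
rewrite partial_scal by assumption.
apply functional_extensionality; intros z; now rewrite Cminus_scal.
Qed.

Lemma continuous_2d (f : C -> R) (x y : R) :
  continuous f (x, y) -> continuity_2d_pt (fun u v => f (u, v)) x y.
Proof.
intros H; apply continuity_2d_pt_filterlim.
apply filterlim_ext with f; [now intros [u v] | exact H].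
Qed.

Lemma dx_dy f : smooth f -> dx (dy f) = dy (dx f).
Proof.
intros Hf.
assert (Hx := smooth_dx Hf); assert (Hy := smooth_dy Hf).
assert (Hxy := smooth_dy Hx); assert (Hyx := smooth_dx Hy).
apply functional_extensionality; intros [x y].
apply injective_projections.
- apply (Schwarz (fun u v => Re (f (u, v))) x y).
  + exists posreal_one; intros u v _ _.
    destruct (smooth_has_partials Hf (u, v)) as (f1 & f2 & f3 & f4).
    destruct (smooth_has_partials Hx (u, v)) as (g1 & g2 & g3 & g4).
    destruct (smooth_has_partials Hy (u, v)) as (h1 & h2 & h3 & h4).
    now repeat split.
  + apply (continuous_2d (f := fun z => Re (dx (dy f) z))).
    now apply continuous_Re, smooth_continuous.
  + apply (continuous_2d (f := fun z => Re (dy (dx f) z))).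
    now apply continuous_Re, smooth_continuous.
- apply (Schwarz (fun u v => Im (f (u, v))) x y).
  + exists posreal_one; intros u v _ _.
    destruct (smooth_has_partials Hf (u, v)) as (f1 & f2 & f3 & f4).
    destruct (smooth_has_partials Hx (u, v)) as (g1 & g2 & g3 & g4).
    destruct (smooth_has_partials Hy (u, v)) as (h1 & h2 & h3 & h4).
    now repeat split.
  + apply (continuous_2d (f := fun z => Im (dx (dy f) z))).
    now apply continuous_Im, smooth_continuous.
  + apply (continuous_2d (f := fun z => Im (dy (dx f) z))).
    now apply continuous_Im, smooth_continuous.
Qed.

Lemma partial_dy a b f : partial a b (dy f) = partial a (S b) f.
Proof.
unfold partial; f_equal.
induction b as [|b IHb]; simpl; [reflexivity | now rewrite IHb].
Qed.

Lemma partial_dx a b f : smooth f -> partial a b (dx f) = partial (S a) b f.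
Proof.
intros Hf; induction a as [|a IHa].
- induction b as [|b IHb]; [reflexivity|].
  change (dy (partial 0 b (dx f)) = dx (dy (partial 0 b f))).
  rewrite IHb, dx_dy; [reflexivity | now apply smooth_partial].
- change (dx (partial a b (dx f)) = dx (partial (S a) b f)); now rewrite IHa.
Qed.

Definition dbar (f : C -> C) : C -> C := fun z =>
  (RtoC (/ 2) * (dx f z + Ci * dy f z))%C.

Lemma smooth_dbar f : smooth f -> smooth (dbar f).
Proof.
intros Hf; apply smooth_scal, smooth_plus; [now apply smooth_dx|].
now apply smooth_scal, smooth_dy.
Qed.

Lemma partial_dbar a b f : smooth f ->
  partial a b (dbar f) =
  (fun z => RtoC (/ 2) * (partial (S a) b f z + Ci * partial a (S b) f z))%C.
Proof.
intros Hf; assert (Hx := smooth_dx Hf); assert (Hy := smooth_dy Hf).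
unfold dbar; rewrite partial_scal by (apply smooth_plus, smooth_scal; assumption).
rewrite partial_plus, partial_scal, partial_dx, partial_dy
  by (try apply smooth_scal; assumption).
reflexivity.
Qed.

Lemma dbar_minus f g : smooth f -> smooth g ->
  dbar (fun z => f z - g z)%C = (fun z => dbar f z - dbar g z)%C.
Proof.
intros Hf Hg; unfold dbar; apply functional_extensionality; intros z.
assert (H1 := partial_minus 1 0 Hf Hg); assert (H2 := partial_minus 0 1 Hf Hg).
unfold partial in H1, H2; simpl in H1, H2; rewrite H1, H2; ring.
Qed.

Lemma dx_const (c : C) : dx (fun _ => c) = (fun _ => RtoC 0).
Proof.
apply functional_extensionality; intros z; unfold dx; now rewrite !Derive_const.
Qed.

Lemma dy_const (c : C) : dy (fun _ => c) = (fun _ => RtoC 0).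
Proof.
apply functional_extensionality; intros z; unfold dy; now rewrite !Derive_const.
Qed.

Lemma smooth_const (c : C) : smooth (fun _ => c).
Proof.
intros k; revert c; induction k as [|k IH]; intros c; simpl.
- split; [intros z; apply continuous_const | exact I].
- split; [intros z; apply continuous_const|].
  rewrite dx_const, dy_const; repeat split; auto; simpl; apply ex_derive_const.
Qed.

Lemma partial_const a b (c : C) :
  partial a b (fun _ => c) = (fun _ => c) /\ a = 0%nat /\ b = 0%nat \/
  partial a b (fun _ => c) = (fun _ => RtoC 0).
Proof.
destruct a as [|a].
- destruct b as [|b]; [left; repeat split; reflexivity | right].
  induction b as [|b IHb]; [apply dy_const|].
  change (dy (partial 0 (S b) (fun _ => c)) = (fun _ => RtoC 0)).
  rewrite IHb; apply dy_const.
- right; change (dx (partial a b (fun _ => c)) = (fun _ => RtoC 0)).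
  assert (H : exists d, partial a b (fun _ => c) = (fun _ => d)).
  { induction a as [|a [d Hd]].
    - induction b as [|b [d Hd]]; [now exists c | exists (RtoC 0)].
      change (dy (partial 0 b (fun _ => c)) = (fun _ => RtoC 0)).
      rewrite Hd; apply dy_const.
    - exists (RtoC 0); change (dx (partial a b (fun _ => c)) = (fun _ => RtoC 0)).
      rewrite Hd; apply dx_const. }
  destruct H as [d ->]; apply dx_const.
Qed.

Definition EM (A : Ctilde -> Prop) (u : net (C -> C)) : Prop :=
  (forall e, smooth (u e)) /\
  forall (a b : nat) (p : Ctilde) (x : net C), A p -> represents p x ->
    moderate (K := C_AbsRing) (fun e => partial a b (u e) (x e)).

Definition NN (A : Ctilde -> Prop) (u : net (C -> C)) : Prop :=
  (forall e, smooth (u e)) /\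
  forall (a b : nat) (p : Ctilde) (x : net C), A p -> represents p x ->
    negligible (K := C_AbsRing) (fun e => partial a b (u e) (x e)).

Definition fun_equiv (A : Ctilde -> Prop) (u v : net (C -> C)) : Prop :=
  NN A (fun e z => (u e z - v e z)%C).

Definition Gtilde (A : Ctilde -> Prop) := quotient (EM A) (@fun_equiv A).

Lemma negligible_zero (K : AbsRing) : negligible (fun _ => zero : K).
Proof.
intros m.
assert (H : 0 < 1) by lra.
generalize (for_small_le H); apply for_small_imp; intros e _.
rewrite abs_zero; left; apply pow_lt, ival_gt0.
Qed.

Lemma negligible_moderate (K : AbsRing) (z : net K) : negligible z -> moderate z.
Proof.
intros H; exists 0%nat; generalize (H 0%nat); apply for_small_imp; intros e.
simpl; rewrite Rinv_1; auto.
Qed.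

Lemma moderate_const (K : AbsRing) (c : K) : moderate (fun _ => c).
Proof.
exists 1%nat.
assert (H0 := abs_ge_0 c).
assert (H : 0 < / (abs c + 1)) by (apply Rinv_0_lt_compat; lra).
generalize (for_small_le H); apply for_small_imp; intros e He.
apply Rinv_le_contravar in He; [|apply ival_gt0].
rewrite Rinv_inv in He; rewrite pow_1; lra.
Qed.

Lemma moderate_mult (K : AbsRing) (x y : net K) :
  moderate x -> moderate y -> moderate (fun e => mult (x e) (y e)).
Proof.
intros [N Hx] [M Hy]; exists (N + M)%nat.
generalize (for_small_and Hx Hy); apply for_small_imp; intros e [H1 H2].
rewrite pow_add, Rinv_mult.
apply Rle_trans with (1 := abs_mult _ _).
apply Rmult_le_compat; try assumption; apply abs_ge_0.
Qed.

Lemma negligible_mult (K : AbsRing) (x y : net K) :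
  moderate x -> negligible y -> negligible (fun e => mult (x e) (y e)).
Proof.
intros [N Hx] Hy m.
generalize (for_small_and Hx (Hy (N + m)%nat)); apply for_small_imp.
intros e [H1 H2].
apply Rle_trans with (1 := abs_mult _ _).
apply Rle_trans with (/ e ^ N * e ^ (N + m)).
- apply Rmult_le_compat; try assumption; apply abs_ge_0.
- rewrite pow_add, <- Rmult_assoc, Rinv_l, Rmult_1_l; [lra|].
  apply pow_nonzero, Rgt_not_eq, ival_gt0.
Qed.

Lemma fun_equiv_is_equiv A : is_equiv (EM A) (@fun_equiv A).
Proof.
split; [|split].
- intros u [Hs Hu]; split.
  + intros e; now apply smooth_minus.
  + intros a b p x Ap px.
    apply (negligible_le (y := fun _ => zero : C_AbsRing));
      [|apply negligible_zero].
    intros e; rewrite partial_minus by auto.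
    right; f_equal.
    change (partial a b (u e) (x e) - partial a b (u e) (x e) = RtoC 0)%C; ring.
- intros u v [us Hu] [vs Hv] [_ H]; split.
  + intros e; now apply smooth_minus.
  + intros a b p x Ap px; generalize (H a b p x Ap px).
    apply negligible_le; intros e; rewrite !partial_minus by auto.
    rewrite <- abs_opp; right; f_equal.
    change (- (partial a b (v e) (x e) - partial a b (u e) (x e)) =
            partial a b (u e) (x e) - partial a b (v e) (x e))%C; ring.
- intros u v w [us Hu] [vs Hv] [ws Hw] [_ H1] [_ H2]; split.
  + intros e; now apply smooth_minus.
  + intros a b p x Ap px.
    generalize (negligible_plus (H1 a b p x Ap px) (H2 a b p x Ap px)).
    apply negligible_le; intros e; rewrite !partial_minus by auto.
    right; f_equal.
    change (partial a b (u e) (x e) - partial a b (w e) (x e) =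
      partial a b (u e) (x e) - partial a b (v e) (x e) +
      (partial a b (v e) (x e) - partial a b (w e) (x e)))%C; ring.
Qed.

Lemma EM_dbar A u : EM A u -> EM A (fun e => dbar (u e)).
Proof.
intros [Hs Hu]; split; [intros e; now apply smooth_dbar|].
intros a b p x Ap px.
apply (moderate_le
  (y := fun e => mult (RtoC (/ 2) : C_AbsRing)
     (plus (partial (S a) b (u e) (x e) : C_AbsRing)
        (mult (Ci : C_AbsRing) (partial a (S b) (u e) (x e)))))).
- intros e; rewrite partial_dbar by auto; apply Rle_refl.
- apply moderate_mult; [apply moderate_const|].
  apply moderate_plus; [now apply (Hu _ _ p)|].
  apply moderate_mult; [apply moderate_const | now apply (Hu _ _ p)].
Qed.

Lemma NN_dbar A u : NN A u -> NN A (fun e => dbar (u e)).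
Proof.
intros [Hs Hu]; split; [intros e; now apply smooth_dbar|].
intros a b p x Ap px.
apply (negligible_le
  (y := fun e => mult (RtoC (/ 2) : C_AbsRing)
     (plus (partial (S a) b (u e) (x e) : C_AbsRing)
        (mult (Ci : C_AbsRing) (partial a (S b) (u e) (x e)))))).
- intros e; rewrite partial_dbar by auto; apply Rle_refl.
- apply negligible_mult; [apply moderate_const|].
  apply negligible_plus; [now apply (Hu _ _ p)|].
  apply negligible_mult; [apply moderate_const | now apply (Hu _ _ p)].
Qed.

Definition gdbar A (u : Gtilde A) : Gtilde A :=
  class (@fun_equiv A) (EM_dbar (repr_dom (@fun_equiv_is_equiv A) u)).

Lemma gdbarE A (u : net (C -> C)) (Hu : EM A u) :
  gdbar (class (@fun_equiv A) Hu) = class (@fun_equiv A) (EM_dbar Hu).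
Proof.
apply class_eq; [apply fun_equiv_is_equiv|].
assert (E := @fun_equiv_is_equiv A).
assert (H := represents_equiv E (reprP (@fun_equiv_is_equiv A) (class (@fun_equiv A) Hu))
  (represents_self E Hu)).
assert (Hr := repr_dom (@fun_equiv_is_equiv A) (class (@fun_equiv A) Hu)).
generalize (NN_dbar H); unfold fun_equiv.
replace (fun e => dbar _) with
  (fun e z => dbar (repr (@fun_equiv_is_equiv A) (class (@fun_equiv A) Hu) e) z
     - dbar (u e) z)%C; [trivial|].
apply functional_extensionality; intros e.
symmetry; apply dbar_minus; [apply Hr | apply Hu].
Qed.

Lemma EM_const A (c : net C) : moderate (K := C_AbsRing) c ->
  EM A (fun e _ => c e).
Proof.
intros Hc; split; [intros e; apply smooth_const|].
intros a b p x _ _; revert Hc; apply moderate_le; intros e.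
destruct (partial_const a b (c e)) as [[-> _] | ->]; [apply Rle_refl|].
change (abs (zero : C_AbsRing) <= abs (c e : C_AbsRing)).
rewrite abs_zero; apply abs_ge_0.
Qed.

Definition gconst A (c : Ctilde) : Gtilde A :=
  class (@fun_equiv A)
    (EM_const A (repr_dom (net_equiv_is_equiv C_AbsRing) c)).

Lemma gconstE A (c : net C_AbsRing) (Hc : moderate c) :
  gconst A (class (@net_equiv C_AbsRing) Hc) = class (@fun_equiv A) (EM_const A Hc).
Proof.
apply class_eq; [apply fun_equiv_is_equiv|].
assert (E := net_equiv_is_equiv C_AbsRing).
assert (H := represents_equiv E
  (reprP (net_equiv_is_equiv C_AbsRing) (class (@net_equiv C_AbsRing) Hc))
  (represents_self E Hc)).
split; [intros e; apply smooth_minus; apply smooth_const|].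
intros a b p x _ _; revert H; apply negligible_le; intros e.
generalize (repr (net_equiv_is_equiv C_AbsRing)
  (class (@net_equiv C_AbsRing) Hc) e); intros r.
destruct (partial_const a b (r - c e)%C) as [[-> _] | ->]; [apply Rle_refl|].
change (abs (zero : C_AbsRing) <= abs (minus (r : C_AbsRing) (c e))).
rewrite abs_zero; apply abs_ge_0.
Qed.

Definition Czero : Ctilde :=
  class (@net_equiv C_AbsRing) (moderate_const (RtoC 0 : C_AbsRing)).

(* For A open in the sharp topology this is the algebra of generalized
   holomorphic functions; openness is not needed for the definition. *)
Definition holomorphic A (u : Gtilde A) : Prop := gdbar u = gconst A Czero.

Lemma moderate_point A (u : Gtilde A) (x : Ctilde) (Ax : A x) :
  moderate (K := C_AbsRing) (fun e =>
    repr (@fun_equiv_is_equiv A) u e (repr (net_equiv_is_equiv C_AbsRing) x e)).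
Proof.
apply (proj2 (repr_dom (@fun_equiv_is_equiv A) u) 0%nat 0%nat x); [assumption|].
apply reprP.
Qed.

Definition point_value A (u : Gtilde A) (x : Ctilde) (Ax : A x) : Ctilde :=
  class (@net_equiv C_AbsRing) (moderate_point u Ax).

Arguments point_value {A} u x Ax.

Definition Ctilde_full : Ctilde -> Prop := fun _ => True.

Lemma mean_value (g : R -> R) (a b : R) : (forall t, ex_derive g t) ->
  exists c, Rabs (c - a) <= Rabs (b - a) /\ g b - g a = Derive g c * (b - a).
Proof.
intros H; destruct (MVT_gen g a b (Derive g)) as (c & Hc & E).
- intros t _; now apply Derive_correct.
- intros t _; apply continuity_pt_filterlim.
  now apply (ex_derive_continuous (V := R_NormedModule)).
- exists c; split; [|assumption].
  revert Hc; unfold Rmin, Rmax, Rabs.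
  destruct (Rle_dec a b), (Rcase_abs (c - a)), (Rcase_abs (b - a)); lra.
Qed.

Lemma Cmod_le_Re_Im (z : C) : Cmod z <= Rabs (Re z) + Rabs (Im z).
Proof.
assert (E : z = (RtoC (Re z) + Ci * RtoC (Im z))%C)
  by (apply injective_projections; unfold Re, Im; simpl; ring).
rewrite E at 1; apply Rle_trans with (1 := Cmod_triangle _ _).
rewrite Cmod_mult, Cmod_Ci, !Cmod_R; lra.
Qed.

Lemma Im_le_Cmod (z : C) : Rabs (Im z) <= Cmod z.
Proof.
apply Rle_trans with (2 := Rmax_Cmod z); apply Rmax_r.
Qed.

Lemma represents_close (p : Ctilde) (x y q : net C) :
  represents p x -> represents p y ->
  (forall e, Cmod (q e - x e)%C <= Cmod (y e - x e)%C) -> represents p q.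
Proof.
intros px py H.
assert (E := net_equiv_is_equiv C_AbsRing).
assert (N : net_equiv (K := C_AbsRing) q x).
{ generalize (represents_equiv E py px); apply negligible_le; exact H. }
apply (represents_closed E px); [|exact N].
apply (moderate_le (K := C_AbsRing)
  (y := fun e => plus (minus (q e : C_AbsRing) (x e)) (x e))).
- intros e; right; f_equal.
  change (q e = q e - x e + x e)%C; ring.
- apply moderate_plus; [now apply negligible_moderate | now apply (represents_dom px)].
Qed.

Lemma mean_value_x (f : C -> C) (z w : C) : smooth f -> Im z = Im w ->
  exists q r : C,
    Cmod (q - z) <= Cmod (w - z) /\ Cmod (r - z) <= Cmod (w - z) /\
    Cmod (f w - f z) <= Cmod (dx f q * (w - z)) + Cmod (dx f r * (w - z)).
Proof.
intros Hf; destruct z as [a y], w as [b y']; intros H; simpl in H; subst y'.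
assert (P := smooth_has_partials Hf).
assert (D : forall c, ((c, y) - (a, y))%C = RtoC (c - a)).
{ intros c; apply injective_projections; simpl; ring. }
destruct (mean_value (g := fun t => Re (f (t, y))) a b) as (c1 & B1 & E1).
{ intros t; apply (P (t, y)). }
destruct (mean_value (g := fun t => Im (f (t, y))) a b) as (c2 & B2 & E2).
{ intros t; apply (P (t, y)). }
exists (c1, y), (c2, y); rewrite !D, !Cmod_mult, !Cmod_R.
split; [assumption | split; [assumption|]].
apply Rle_trans with (1 := Cmod_le_Re_Im _).
apply Rplus_le_compat.
- replace (Re (f (b, y) - f (a, y))%C) with (Re (f (b, y)) - Re (f (a, y)))
    by reflexivity.
  rewrite E1, Rabs_mult; apply Rmult_le_compat_r; [apply Rabs_pos|].
  apply (re_le_Cmod (dx f (c1, y))).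
- replace (Im (f (b, y) - f (a, y))%C) with (Im (f (b, y)) - Im (f (a, y)))
    by reflexivity.
  rewrite E2, Rabs_mult; apply Rmult_le_compat_r; [apply Rabs_pos|].
  apply (Im_le_Cmod (dx f (c2, y))).
Qed.

Lemma mean_value_y (f : C -> C) (z w : C) : smooth f -> Re z = Re w ->
  exists q r : C,
    Cmod (q - z) <= Cmod (w - z) /\ Cmod (r - z) <= Cmod (w - z) /\
    Cmod (f w - f z) <= Cmod (dy f q * (w - z)) + Cmod (dy f r * (w - z)).
Proof.
intros Hf; destruct z as [x a], w as [x' b]; intros H; simpl in H; subst x'.
assert (P := smooth_has_partials Hf).
assert (D : forall c, ((x, c) - (x, a))%C = (Ci * RtoC (c - a))%C).
{ intros c; apply injective_projections; simpl; ring. }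
destruct (mean_value (g := fun t => Re (f (x, t))) a b) as (c1 & B1 & E1).
{ intros t; apply (P (x, t)). }
destruct (mean_value (g := fun t => Im (f (x, t))) a b) as (c2 & B2 & E2).
{ intros t; apply (P (x, t)). }
exists (x, c1), (x, c2); rewrite !D, !Cmod_mult, !Cmod_Ci, !Cmod_R, !Rmult_1_l.
split; [assumption | split; [assumption|]].
apply Rle_trans with (1 := Cmod_le_Re_Im _).
apply Rplus_le_compat.
- replace (Re (f (x, b) - f (x, a))%C) with (Re (f (x, b)) - Re (f (x, a)))
    by reflexivity.
  rewrite E1, Rabs_mult; apply Rmult_le_compat_r; [apply Rabs_pos|].
  apply (re_le_Cmod (dy f (x, c1))).
- replace (Im (f (x, b) - f (x, a))%C) with (Im (f (x, b)) - Im (f (x, a)))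
    by reflexivity.
  rewrite E2, Rabs_mult; apply Rmult_le_compat_r; [apply Rabs_pos|].
  apply (Im_le_Cmod (dy f (x, c2))).
Qed.

Lemma EM_step A (a b : nat) (u : net (C -> C)) (p : Ctilde) (x y : net C) :
  EM A u -> A p -> represents p x -> represents p y ->
  (forall e, exists q r : C,
    Cmod (q - x e) <= Cmod (y e - x e) /\ Cmod (r - x e) <= Cmod (y e - x e) /\
    Cmod (u e (y e) - u e (x e)) <=
      Cmod (partial a b (u e) q * (y e - x e)) +
      Cmod (partial a b (u e) r * (y e - x e))) ->
  negligible (K := C_AbsRing) (fun e => u e (y e) - u e (x e))%C.
Proof.
intros [_ Hu] Ap px py H.
assert (N := represents_equiv (net_equiv_is_equiv C_AbsRing) py px).
destruct (functional_choice _ H) as [q Hq].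
destruct (functional_choice _ Hq) as [r Hr].
assert (pq : represents p q).
{ apply (represents_close px py); intros e; apply (Hr e). }
assert (pr : represents p r).
{ apply (represents_close px py); intros e; apply (Hr e). }
apply (negligible_bound
  (negligible_mult (Hu a b p q Ap pq) N) (negligible_mult (Hu a b p r Ap pr) N)).
assert (H1 : 0 < 1) by lra.
generalize (for_small_le H1); apply for_small_imp; intros e _; apply (Hr e).
Qed.

Lemma EM_point A (u : net (C -> C)) (p : Ctilde) (x y : net C) :
  EM A u -> A p -> represents p x -> represents p y ->
  negligible (K := C_AbsRing) (fun e => u e (y e) - u e (x e))%C.
Proof.
intros Hu Ap px py.
set (w := (fun e => (Re (y e), Im (x e)) : C) : net C).
assert (pw : represents p w).
{ apply (represents_close px py); intros e.
  replace (w e - x e)%C with (RtoC (Re (y e - x e)%C));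
    [rewrite Cmod_R; apply re_le_Cmod|].
  apply injective_projections; unfold w, Re, Im; simpl; ring. }
assert (H1 : negligible (K := C_AbsRing) (fun e => u e (w e) - u e (x e))%C).
{ apply (EM_step (a := 1) (b := 0) Hu Ap px pw); intros e.
  now apply mean_value_x; [apply Hu|]. }
assert (H2 : negligible (K := C_AbsRing) (fun e => u e (y e) - u e (w e))%C).
{ apply (EM_step (a := 0) (b := 1) Hu Ap pw py); intros e.
  now apply mean_value_y; [apply Hu|]. }
generalize (negligible_plus H1 H2); apply negligible_le; intros e.
right; f_equal.
change (u e (y e) - u e (x e) =
  u e (w e) - u e (x e) + (u e (y e) - u e (w e)))%C; ring.
Qed.

Lemma point_valueE A (u : Gtilde A) (p : Ctilde) (Ap : A p)
    (v : net (C -> C)) (x : net C) :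
  represents u v -> represents p x ->
  represents (point_value u p Ap) (fun e => v e (x e)).
Proof.
intros uv px.
assert (E := @fun_equiv_is_equiv A); assert (EC := net_equiv_is_equiv C_AbsRing).
assert (Hv := represents_dom uv).
split; [now apply (proj2 Hv 0%nat 0%nat p)|].
assert (H1 := EM_point Hv Ap (reprP EC p) px).
assert (H2 := proj2 (represents_equiv E uv (reprP E u))
  0%nat 0%nat p (repr EC p) Ap (reprP EC p)).
generalize (negligible_plus H1 H2); apply negligible_le; intros e.
right; f_equal.
rewrite (proof_irrelevance _ E (@fun_equiv_is_equiv A)).
rewrite (proof_irrelevance _ EC (net_equiv_is_equiv C_AbsRing)).
set (r := repr (net_equiv_is_equiv C_AbsRing) p e).
set (w := repr (@fun_equiv_is_equiv A) u e).
change (v e (x e) - w r = v e (x e) - v e r + (v e r - w r))%C; ring.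
Qed.

(* Main.v *)
Require Import Defs.
From Stdlib Require Import Reals Lra Lia Classical.
From Stdlib Require Import FunctionalExtensionality IndefiniteDescription.
From Coquelicot Require Import Coquelicot.

(* For smooth f let J(r) be the integral over t in [0, 2 pi] of the real part of
   f(z + r e^(i t)) e^(- i t).  Integration by parts in t gives (J/r)' = E/r, where
   E(r) is the integral of the real part of 2 (dbar f)(z + r e^(i t)) e^(- 2 i t),
   and J/r tends to pi (Re f_x + Im f_y)(z) as r -> 0.  Since E(r) = O(d r) if d
   bounds dbar f and its first derivatives, this yields a Cauchy estimate
   |f_x(z)|, |f_y(z)| <= 4 M / r + 32 d r + 2 d for smooth functions that are only
   almost holomorphic.  For a bounded generalized holomorphic function, the bound M = e^(-k)
   does not depend on the radius r = e^(-N) and d is smaller than any power of e,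
   so the first derivatives are negligible.  They are then themselves bounded with
   negligible dbar, so by iteration all derivatives are negligible, and
   u(x) - u(0) is negligible by the mean value theorem. *)

Set Implicit Arguments.
Unset Strict Implicit.
Open Scope R_scope.

(** * Chain rule for functions on the plane *)

(** Differentiability of [p] at the point follows from continuity there of one partial derivative,
    [px], and mere existence of the other. *)
Lemma is_derive_comp_2d (p px : C -> R) (py a' b' t : R) (a b : R -> R) :
  (forall z, is_derive (fun s => p (s, Im z)) (Re z) (px z)) ->
  is_derive (fun s => p (a t, s)) (b t) py ->
  continuous px (a t, b t) ->
  is_derive a t a' -> is_derive b t b' ->
  is_derive (fun s => p (a s, b s)) t (px (a t, b t) * a' + py * b').
Proof.
intros Hx Hy Hc Ha Hb.
apply is_derive_Reals, (derivable_pt_lim_comp_2d (fun u v => p (u, v)));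
  [| now apply is_derive_Reals ..].
apply filterdiff_differentiable_pt_lim.
apply (is_derive_filterdiff (fun u v => p (u, v)) (a t) (b t)
  (fun u v => px (u, v)) py).
- apply filter_forall; intros [u v]; exact (Hx (u, v)).
- exact Hy.
- apply continuous_ext with (2 := Hc); now intros [u v].
Qed.

Lemma is_derive_Re_comp (f : C -> C) (a b : R -> R) (a' b' t : R) :
  smooth f -> is_derive a t a' -> is_derive b t b' ->
  is_derive (fun s => Re (f (a s, b s))) t
    (Re (dx f (a t, b t)) * a' + Re (dy f (a t, b t)) * b').
Proof.
intros Hf; assert (P := smooth_has_partials Hf).
apply (is_derive_comp_2d (p := fun z => Re (f z)) (px := fun z => Re (dx f z))).
- intros z; apply Derive_correct, P.
- apply (Derive_correct (fun s => Re (f (a t, s)))), (P (a t, b t)).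
- now apply continuous_Re, smooth_continuous, smooth_dx.
Qed.

Lemma is_derive_Im_comp (f : C -> C) (a b : R -> R) (a' b' t : R) :
  smooth f -> is_derive a t a' -> is_derive b t b' ->
  is_derive (fun s => Im (f (a s, b s))) t
    (Im (dx f (a t, b t)) * a' + Im (dy f (a t, b t)) * b').
Proof.
intros Hf; assert (P := smooth_has_partials Hf).
apply (is_derive_comp_2d (p := fun z => Im (f z)) (px := fun z => Im (dx f z))).
- intros z; apply Derive_correct, P.
- apply (Derive_correct (fun s => Im (f (a t, s)))), (P (a t, b t)).
- now apply continuous_Im, smooth_continuous, smooth_dx.
Qed.

(** * Joint continuity in polar coordinates *)

Lemma continuity_2d_pt_continuous (h : R -> R -> R) (r t : R) :
  continuity_2d_pt h r t -> continuous (h r) t.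
Proof.
intros H; apply continuity_pt_filterlim, continuity_pt_locally; intros eps.
destruct (H eps) as [d Hd]; exists d; intros y Hy; apply Hd; [|exact Hy].
rewrite Rminus_diag, Rabs_R0; apply cond_pos.
Qed.

Lemma continuity_2d_pt_right (g : R -> R) (r t : R) :
  continuous g t -> continuity_2d_pt (fun _ v => g v) r t.
Proof.
intros H; apply (continuity_1d_2d_pt_comp g (fun _ v => v)).
- now apply continuity_pt_filterlim.
- apply continuity_2d_pt_id2.
Qed.

Definition polar (z : C) (r t : R) : C := (Re z + r * cos t, Im z + r * sin t).

Lemma polar_0 z t : polar z 0 t = z.
Proof. destruct z; unfold polar; simpl; f_equal; ring. Qed.

Lemma Cmod_polar z r t : 0 <= r -> Cmod (polar z r t - z) = r.
Proof.
intros Hr; unfold Cmod, polar; simpl.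
replace (_ + _) with (r ^ 2 * (Rsqr (sin t) + Rsqr (cos t)))
  by (unfold Rsqr, Re, Im; simpl; ring).
rewrite sin2_cos2, Rmult_1_r; now apply sqrt_pow2.
Qed.

Lemma continuous_polar z (p : C) :
  continuous (fun q : C => polar z (fst q) (snd q)) p.
Proof.
destruct p as [r t]; apply continuous_C.
- apply (proj1 (continuity_2d_pt_filterlim (fun r t => Re z + r * cos t) r t)).
  apply continuity_2d_pt_plus; [apply continuity_2d_pt_const|].
  apply continuity_2d_pt_mult; [apply continuity_2d_pt_id1|].
  apply continuity_2d_pt_right, continuous_cos.
- apply (proj1 (continuity_2d_pt_filterlim (fun r t => Im z + r * sin t) r t)).
  apply continuity_2d_pt_plus; [apply continuity_2d_pt_const|].
  apply continuity_2d_pt_mult; [apply continuity_2d_pt_id1|].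
  apply continuity_2d_pt_right, continuous_sin.
Qed.

Lemma continuity_2d_pt_Re_polar w z r t :
  smooth w -> continuity_2d_pt (fun r t => Re (w (polar z r t))) r t.
Proof.
intros Hw; apply continuity_2d_pt_filterlim.
apply (continuous_Re (f := fun q : C => w (polar z (fst q) (snd q)))).
apply continuous_comp; [apply continuous_polar | now apply smooth_continuous].
Qed.

Lemma continuity_2d_pt_Im_polar w z r t :
  smooth w -> continuity_2d_pt (fun r t => Im (w (polar z r t))) r t.
Proof.
intros Hw; apply continuity_2d_pt_filterlim.
apply (continuous_Im (f := fun q : C => w (polar z (fst q) (snd q)))).
apply continuous_comp; [apply continuous_polar | now apply smooth_continuous].
Qed.

(* The leaves come first: [continuity_2d_pt_mult] would unfold [Re (dbar f _)]. *)
Ltac cont_2d := repeat first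
  [ apply continuity_2d_pt_Re_polar | apply continuity_2d_pt_Im_polar
  | apply continuity_2d_pt_minus | apply continuity_2d_pt_plus
  | apply continuity_2d_pt_mult | apply continuity_2d_pt_id1
  | apply continuity_2d_pt_const
  | apply (continuity_2d_pt_right (g := cos)), continuous_cos
  | apply (continuity_2d_pt_right (g := sin)), continuous_sin ].

Lemma ex_RInt_2d (h : R -> R -> R) (r a b : R) :
  (forall t, continuity_2d_pt h r t) -> ex_RInt (h r) a b.
Proof.
intros H; apply (ex_RInt_continuous (V := R_CompleteNormedModule)).
intros t _; now apply continuity_2d_pt_continuous.
Qed.

(** * Integrals over circles *)

(** The integrand is the real part of 2 (a + i b) e^(- 2 i t). This allows a constant to be
    subtracted from [dbar f] inside the integral of [source]. *)
Lemma is_RInt_double_angle (a b : R) :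
  is_RInt (fun t => 2 * a * (cos t * cos t - sin t * sin t)
    + 2 * b * (2 * (sin t * cos t))) 0 (2 * PI) 0.
Proof.
set (F := fun t => 2 * a * (sin t * cos t) + 2 * b * (sin t * sin t)).
replace 0 with (minus (F (2 * PI)) (F 0)) at 2
  by (unfold F; rewrite sin_2PI, cos_2PI, sin_0, cos_0;
      unfold minus, plus, opp; simpl; ring).
apply (is_RInt_derive F).
- intros t _; unfold F; auto_derive; trivial; ring.
- intros t _.
  apply (continuity_2d_pt_continuous (h := fun _ t =>
    2 * a * (cos t * cos t - sin t * sin t)
    + 2 * b * (2 * (sin t * cos t))) (r := 0)).
  cont_2d.
Qed.

Section Circle.
Variables (f : C -> C) (z : C).
Hypothesis Hf : smooth f.

Let Hx : smooth (dx f) := smooth_dx Hf.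
Let Hy : smooth (dy f) := smooth_dy Hf.

(* Real and imaginary parts of f(z + r e^(i t)) e^(- i t). *)
Definition rotRe r t :=
  Re (f (polar z r t)) * cos t + Im (f (polar z r t)) * sin t.
Definition rotIm r t :=
  Im (f (polar z r t)) * cos t - Re (f (polar z r t)) * sin t.

(** Real part of e^(- i t) times the radial derivative of f. *)
Definition rotRe_r r t :=
  (Re (dx f (polar z r t)) * cos t + Re (dy f (polar z r t)) * sin t) * cos t
  + (Im (dx f (polar z r t)) * cos t + Im (dy f (polar z r t)) * sin t) * sin t.

(* Real part of 2 (dbar f)(z + r e^(i t)) e^(- 2 i t). *)
Definition source r t :=
  2 * Re (dbar f (polar z r t)) * (cos t * cos t - sin t * sin t)
  + 2 * Im (dbar f (polar z r t)) * (2 * (sin t * cos t)).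

(** The J(r) of the overview; it is not divided by 2 pi. *)
Definition circle_mean r := RInt (rotRe r) 0 (2 * PI).

Lemma is_derive_polar_r (t r : R) :
  is_derive (fun r => Re z + r * cos t) r (cos t) /\
  is_derive (fun r => Im z + r * sin t) r (sin t).
Proof. split; auto_derive; trivial; ring. Qed.

Lemma is_derive_polar_t (r t : R) :
  is_derive (fun t => Re z + r * cos t) t (- (r * sin t)) /\
  is_derive (fun t => Im z + r * sin t) t (r * cos t).
Proof. split; auto_derive; trivial; ring. Qed.

Lemma is_derive_rotRe r t : is_derive (fun r => rotRe r t) r (rotRe_r r t).
Proof.
destruct (is_derive_polar_r t r) as [Ha Hb].
assert (H1 := is_derive_Re_comp Hf Ha Hb).
assert (H2 := is_derive_Im_comp Hf Ha Hb).
apply (is_derive_plus (V := R_NormedModule));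
  now apply (is_derive_scal_l (K := R_AbsRing) (V := R_NormedModule)).
Qed.

(** In polar coordinates f_r + (i/r) f_t = 2 e^(- i t) dbar f, so r f_r e^(- i t) and f_t e^(- i t)
    are linked through [source]. The term [rotRe] comes from differentiating e^(- i t). *)
Lemma is_derive_rotIm r t :
  is_derive (rotIm r) t (r * (rotRe_r r t - source r t) - rotRe r t).
Proof.
destruct (is_derive_polar_t r t) as [Ha Hb].
assert (H1 := is_derive_Re_comp Hf Ha Hb).
assert (H2 := is_derive_Im_comp Hf Ha Hb).
apply is_derive_Reals in H1; apply is_derive_Reals in H2.
apply is_derive_Reals.
assert (H3 := derivable_pt_lim_minus _ _ _ _ _
  (derivable_pt_lim_mult _ _ _ _ _ H2 (derivable_pt_lim_cos t))
  (derivable_pt_lim_mult _ _ _ _ _ H1 (derivable_pt_lim_sin t))).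
match type of H3 with derivable_pt_lim _ _ ?l =>
  replace (r * (rotRe_r r t - source r t) - rotRe r t) with l; [exact H3|] end.
unfold rotRe, rotRe_r, source, dbar, polar.
set (p := (_, _)).
destruct (dx f p) as [x1 x2], (dy f p) as [y1 y2], (f p) as [p1 p2].
unfold Re, Im; simpl; field.
Qed.

Lemma is_derive_circle_mean r :
  is_derive circle_mean r (RInt (rotRe_r r) 0 (2 * PI)).
Proof.
assert (E : forall u v, Derive (fun s => rotRe s v) u = rotRe_r u v).
{ intros u v; apply is_derive_unique, is_derive_rotRe. }
rewrite (RInt_ext (rotRe_r r) (fun t => Derive (fun s => rotRe s t) r))
  by (intros t _; symmetry; apply E).
apply (is_derive_RInt_param rotRe).
- apply filter_forall; intros u t _; exists (rotRe_r u t); apply is_derive_rotRe.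
- intros t _; apply continuity_2d_pt_ext with rotRe_r; [intros; symmetry; apply E|].
  unfold rotRe_r; cont_2d; assumption.
- apply filter_forall; intros u; apply ex_RInt_2d; intros t.
  unfold rotRe; cont_2d; assumption.
Qed.

Lemma circle_mean_0 : circle_mean 0 = 0.
Proof.
unfold circle_mean, rotRe.
rewrite (RInt_ext _ (fun t => Re (f z) * cos t + Im (f z) * sin t))
  by (intros t _; now rewrite polar_0).
apply is_RInt_unique.
replace 0 with (minus
  (Re (f z) * sin (2 * PI) - Im (f z) * cos (2 * PI))
  (Re (f z) * sin 0 - Im (f z) * cos 0)) at 2
  by (rewrite sin_2PI, cos_2PI, sin_0, cos_0; unfold minus, plus, opp; simpl; ring).
apply (is_RInt_derive (fun t => Re (f z) * sin t - Im (f z) * cos t)).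
- intros t _; auto_derive; trivial; ring.
- intros t _.
  apply (continuity_2d_pt_continuous (h := fun _ t => Re (f z) * cos t + Im (f z) * sin t) (r := 0)).
  cont_2d.
Qed.

(** Integrate [is_derive_rotIm] over a full period: the boundary terms of [rotIm] cancel. Divided by
    r^2, this is (J/r)' = E/r. *)
Lemma circle_mean_ode r :
  r * RInt (rotRe_r r) 0 (2 * PI) - circle_mean r = r * RInt (source r) 0 (2 * PI).
Proof.
assert (Hd := smooth_dbar Hf).
assert (C1 : forall t, continuity_2d_pt rotRe_r r t)
  by (intros t; unfold rotRe_r; cont_2d; assumption).
assert (C2 : forall t, continuity_2d_pt source r t)
  by (intros t; unfold source; cont_2d; assumption).
assert (C3 : forall t, continuity_2d_pt rotRe r t)
  by (intros t; unfold rotRe; cont_2d; assumption).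
assert (I1 := ex_RInt_2d 0 (2 * PI) C1).
assert (I2 := ex_RInt_2d 0 (2 * PI) C2).
assert (I3 := ex_RInt_2d 0 (2 * PI) C3).
assert (H := is_RInt_derive (V := R_CompleteNormedModule) (rotIm r)
  (fun t => r * (rotRe_r r t - source r t) - rotRe r t) 0 (2 * PI)
  (fun t _ => is_derive_rotIm r t)).
assert (Hc : forall t, Rmin 0 (2 * PI) <= t <= Rmax 0 (2 * PI) ->
  continuous (fun t => r * (rotRe_r r t - source r t) - rotRe r t) t).
{ intros t _.
  apply (continuity_2d_pt_continuous
    (h := fun r t => r * (rotRe_r r t - source r t) - rotRe r t)).
  cont_2d; auto. }
specialize (H Hc); apply is_RInt_unique in H.
rewrite (RInt_minus (V := R_CompleteNormedModule)
  (fun t => r * (rotRe_r r t - source r t)) (rotRe r)) in H;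
  [| apply (ex_RInt_scal (V := R_NormedModule)), (ex_RInt_minus (V := R_NormedModule)); assumption
   | assumption].
rewrite (RInt_scal (V := R_CompleteNormedModule)
  (fun t => rotRe_r r t - source r t)) in H
  by (apply (ex_RInt_minus (V := R_NormedModule)); assumption).
rewrite (RInt_minus (V := R_CompleteNormedModule) (rotRe_r r) (source r)) in H
  by assumption.
unfold rotIm at 1 2, polar in H.
rewrite cos_2PI, sin_2PI, cos_0, sin_0 in H.
rewrite minus_eq_zero in H; unfold circle_mean.
change (r * (RInt (rotRe_r r) 0 (2 * PI) - RInt (source r) 0 (2 * PI))
  - RInt (rotRe r) 0 (2 * PI) = 0) in H; lra.
Qed.

(** At radius 0 the partial derivatives are constants; cos^2 and sin^2 integrate to pi and the mixed
    term to 0. The value is J'(0), the limit of J(r)/r. *)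
Lemma RInt_rotRe_r_0 :
  RInt (rotRe_r 0) 0 (2 * PI) = PI * (Re (dx f z) + Im (dy f z)).
Proof.
unfold rotRe_r.
set (F := fun t => Re (dx f z) * ((t + sin t * cos t) / 2)
  + (Re (dy f z) + Im (dx f z)) * (sin t * sin t / 2)
  + Im (dy f z) * ((t - sin t * cos t) / 2)).
rewrite (RInt_ext _ (fun t =>
  (Re (dx f z) * cos t + Re (dy f z) * sin t) * cos t
  + (Im (dx f z) * cos t + Im (dy f z) * sin t) * sin t))
  by (intros t _; now rewrite polar_0).
apply is_RInt_unique.
replace (PI * (Re (dx f z) + Im (dy f z))) with (minus (F (2 * PI)) (F 0))
  by (unfold F; rewrite sin_2PI, cos_2PI, sin_0, cos_0;
      unfold minus, plus, opp; simpl; field).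
apply (is_RInt_derive F).
- intros t _; unfold F.
  generalize (Re (dx f z)) (Im (dx f z)) (Re (dy f z)) (Im (dy f z)).
  intros x1 x2 y1 y2; auto_derive; trivial.
  assert (E := sin2_cos2 t); unfold Rsqr in E.
  replace ((1 + (1 * cos t * cos t + sin t * (1 * - sin t))) * / 2)
    with (cos t * cos t) by lra.
  replace ((1 + - (1 * cos t * cos t + sin t * (1 * - sin t))) * / 2)
    with (sin t * sin t) by lra.
  field.
- intros t _.
  apply (continuity_2d_pt_continuous (h := fun _ t =>
    (Re (dx f z) * cos t + Re (dy f z) * sin t) * cos t
    + (Im (dx f z) * cos t + Im (dy f z) * sin t) * sin t) (r := 0)).
  cont_2d.
Qed.

End Circle.

(** * Lipschitz and Cauchy estimates *)

(** Go from z to p along a horizontal and a vertical leg. Each leg costs 2 d |p - z|, since the mean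
    value theorem acts on real and imaginary parts separately. Intermediate points of the second leg
    are near the corner, hence only within 2 |p - z| of z. *)
Lemma lipschitz (w : C -> C) (z p : C) (d : R) : smooth w ->
  (forall q, Cmod (q - z) <= 2 * Cmod (p - z) ->
    Cmod (dx w q) <= d /\ Cmod (dy w q) <= d) ->
  Cmod (w p - w z) <= 4 * d * Cmod (p - z).
Proof.
intros Hw Hd.
set (q := (Re p, Im z) : C).
assert (H1 : Cmod (q - z) <= Cmod (p - z)).
{ replace (q - z)%C with (RtoC (Re (p - z)%C)); [rewrite Cmod_R; apply re_le_Cmod|].
  apply injective_projections; unfold q, Re, Im; simpl; ring. }
assert (H2 : Cmod (p - q) <= Cmod (p - z)).
{ replace (p - q)%C with (Ci * RtoC (Im (p - z)%C))%C;
    [rewrite Cmod_mult, Cmod_Ci, Cmod_R, Rmult_1_l; apply Im_le_Cmod|].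
  apply injective_projections; unfold q, Re, Im; simpl; ring. }
assert (P := Cmod_ge_0 (p - z)).
destruct (@mean_value_x w z q Hw eq_refl) as (a & b & Ha & Hb & E1).
destruct (@mean_value_y w q p Hw eq_refl) as (a' & b' & Ha' & Hb' & E2).
assert (T : forall c, Cmod (c - q) <= Cmod (p - q) ->
  Cmod (c - z) <= 2 * Cmod (p - z)).
{ intros c Hc; replace (c - z)%C with ((c - q) + (q - z))%C by ring.
  apply Rle_trans with (1 := Cmod_triangle _ _); lra. }
assert (Da : Cmod (dx w a) <= d) by (apply Hd; lra).
assert (Db : Cmod (dx w b) <= d) by (apply Hd; lra).
assert (Da' : Cmod (dy w a') <= d) by (now apply Hd, T).
assert (Db' : Cmod (dy w b') <= d) by (now apply Hd, T).
rewrite !Cmod_mult in E1, E2.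
replace (w p - w z)%C with ((w p - w q) + (w q - w z))%C by ring.
apply Rle_trans with (1 := Cmod_triangle _ _).
assert (M : forall s t, 0 <= s <= d -> 0 <= t <= Cmod (p - z) ->
  s * t <= d * Cmod (p - z)) by (intros; apply Rmult_le_compat; lra).
generalize (M _ _ (conj (Cmod_ge_0 _) Da) (conj (Cmod_ge_0 _) H1))
  (M _ _ (conj (Cmod_ge_0 _) Db) (conj (Cmod_ge_0 _) H1))
  (M _ _ (conj (Cmod_ge_0 _) Da') (conj (Cmod_ge_0 _) H2))
  (M _ _ (conj (Cmod_ge_0 _) Db') (conj (Cmod_ge_0 _) H2)); lra.
Qed.

Lemma Rabs_lin_le (a b c s M : R) : Rabs a <= M -> Rabs b <= M ->
  Rabs c <= 1 -> Rabs s <= 1 -> Rabs (a * c + b * s) <= 2 * M.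
Proof.
intros Ha Hb Hc Hs.
apply Rle_trans with (1 := Rabs_triang _ _); rewrite !Rabs_mult.
generalize (Rabs_pos a) (Rabs_pos b) (Rabs_pos c) (Rabs_pos s); nra.
Qed.

Lemma Rabs_sin t : Rabs (sin t) <= 1.
Proof. apply Rabs_le, SIN_bound. Qed.

Lemma Rabs_cos t : Rabs (cos t) <= 1.
Proof. apply Rabs_le, COS_bound. Qed.

Section Estimate.
Variables (f : C -> C) (z : C) (rad M d : R).
Hypothesis Hf : smooth f.
Hypothesis rad_gt0 : 0 < rad.
Hypothesis bound_f : forall q, Cmod (q - z) <= rad -> Cmod (f q) <= M.
Hypothesis bound_dbar : forall q, Cmod (q - z) <= 2 * rad ->
  Cmod (dx (dbar f) q) <= d /\ Cmod (dy (dbar f) q) <= d.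

Lemma circle_mean_le : Rabs (circle_mean f z rad) <= 2 * PI * (2 * M).
Proof.
assert (P := PI_RGT_0).
replace (2 * PI * (2 * M)) with ((2 * PI - 0) * (2 * M)) by ring.
apply abs_RInt_le_const; [lra | |].
- apply (ex_RInt_2d (h := rotRe f z)); intros t; unfold rotRe; cont_2d; assumption.
- intros t _; unfold rotRe.
  assert (B : Cmod (f (polar z rad t)) <= M)
    by (apply bound_f; rewrite Cmod_polar; lra).
  apply Rabs_lin_le; [| | apply Rabs_cos | apply Rabs_sin].
  + apply Rle_trans with (2 := B), re_le_Cmod.
  + apply Rle_trans with (2 := B), Im_le_Cmod.
Qed.

(* The constant [dbar f z] integrates to 0 against e^(- 2 i t), so only the
   oscillation of [dbar f] on the circle contributes. *)
Lemma RInt_source_le r : 0 < r <= rad ->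
  Rabs (RInt (source f z r) 0 (2 * PI)) <= 32 * PI * d * r.
Proof.
intros Hr; assert (P := PI_RGT_0).
assert (Hd := smooth_dbar Hf).
assert (C1 : forall t, continuity_2d_pt (source f z) r t)
  by (intros t; unfold source; cont_2d; assumption).
assert (I1 := ex_RInt_2d 0 (2 * PI) C1).
set (a := Re (dbar f z)); set (b := Im (dbar f z)).
assert (I2 := is_RInt_double_angle a b).
assert (E := RInt_minus (V := R_CompleteNormedModule) _ _ _ _ I1
  (ex_intro _ _ I2)).
rewrite (is_RInt_unique _ _ _ _ I2) in E.
assert (E' : RInt (source f z r) 0 (2 * PI) = RInt (fun t => minus (source f z r t)
  (2 * a * (cos t * cos t - sin t * sin t)
    + 2 * b * (2 * (sin t * cos t)))) 0 (2 * PI)).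
{ refine (eq_trans _ (eq_sym E)); symmetry.
  apply (minus_zero_r (G := R_AbelianGroup)). }
rewrite E'.
(* Length of the interval, times 2 from [Rabs_lin_le], times the factor 2 in [source], times the
   Lipschitz bound 4 d r. *)
replace (32 * PI * d * r) with ((2 * PI - 0) * (2 * (2 * (4 * d * r)))) by ring.
apply abs_RInt_le_const; [lra | |].
- apply (ex_RInt_minus (V := R_NormedModule)); [assumption | now exists 0].
- intros t _.
  assert (N := Cmod_polar z t (Rlt_le _ _ (proj1 Hr))).
  assert (B : Cmod (dbar f (polar z r t) - dbar f z) <= 4 * d * r).
  { rewrite <- N at 2; apply lipschitz; [assumption|].
    intros q; rewrite N; intros Hq; apply bound_dbar; lra. }
  replace (minus _ _) with
    (2 * Re (dbar f (polar z r t) - dbar f z)%C * cos (2 * t)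
     + 2 * Im (dbar f (polar z r t) - dbar f z)%C * sin (2 * t)).
  + apply Rabs_lin_le; [| | apply Rabs_cos | apply Rabs_sin];
      rewrite Rabs_mult, (Rabs_pos_eq 2) by lra; apply Rmult_le_compat_l; try lra.
    * apply Rle_trans with (2 := B), re_le_Cmod.
    * apply Rle_trans with (2 := B), Im_le_Cmod.
  + rewrite cos_2a, sin_2a; unfold source, a, b.
    unfold minus, plus, opp; simpl; unfold Re, Im; simpl; ring.
Qed.

(** Mean value theorem for J(s)/s, whose derivative E(s)/s is at most 32 pi d because E(s) = O(d s).
    The bound is uniform in r, so r can tend to 0. *)
Lemma circle_mean_slope_diff r : 0 < r < rad ->
  Rabs (circle_mean f z rad / rad - circle_mean f z r / r) <= 32 * PI * d * rad.
Proof.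
intros Hr.
set (h := fun s => circle_mean f z s / s).
assert (D : forall s, r <= s <= rad ->
  is_derive h s (RInt (source f z s) 0 (2 * PI) / s)).
{ intros s Hs; assert (D := is_derive_circle_mean z Hf s).
  assert (O := circle_mean_ode z Hf s).
  replace (RInt (source f z s) 0 (2 * PI) / s) with
    ((RInt (rotRe_r f z s) 0 (2 * PI) * s - circle_mean f z s * 1) / s ^ 2).
  - apply (is_derive_div (circle_mean f z) (fun s => s)); [assumption | | lra].
    apply (is_derive_id (K := R_AbsRing)).
  - replace (_ - _) with (s * RInt (source f z s) 0 (2 * PI)) by lra.
    field; lra. }
destruct (MVT_gen h r rad (fun s => RInt (source f z s) 0 (2 * PI) / s))
  as (c & Hc & Ec); rewrite ?Rmin_left, ?Rmax_right in * by lra.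
- intros s Hs; apply D; lra.
- intros s Hs; apply continuity_pt_filterlim.
  apply (ex_derive_continuous (V := R_NormedModule)).
  eexists; now apply D.
- fold (h rad) (h r); rewrite Ec, Rabs_mult.
  unfold Rdiv; rewrite Rabs_mult, Rabs_inv, (Rabs_pos_eq c), (Rabs_pos_eq (rad - r)) by lra.
  assert (B := @RInt_source_le c ltac:(lra)).
  assert (B' : Rabs (RInt (source f z c) 0 (2 * PI)) * / c <= 32 * PI * d).
  { apply Rmult_le_reg_r with c; [lra|]; rewrite Rmult_assoc, Rinv_l; lra. }
  apply Rmult_le_compat; try lra.
  apply Rmult_le_pos; [apply Rabs_pos | left; apply Rinv_0_lt_compat; lra].
Qed.

(** As J(0) = 0, J(r)/r is a difference quotient of J at 0 and tends to pi times the left-hand side;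
    compare it with J(rad)/rad. *)
Lemma Cauchy_estimate_Re :
  Rabs (Re (dx f z) + Im (dy f z)) <= 4 * M / rad + 32 * d * rad.
Proof.
assert (P := PI_RGT_0).
assert (D := is_derive_circle_mean z Hf 0); rewrite RInt_rotRe_r_0 in D.
set (l := Re (dx f z) + Im (dy f z)) in *.
apply is_derive_Reals in D.
enough (H : Rabs (PI * l) <= PI * (4 * M / rad + 32 * d * rad)).
{ rewrite Rabs_mult, (Rabs_pos_eq PI) in H by lra.
  now apply Rmult_le_reg_l in H. }
apply le_epsilon; intros eps Heps.
destruct (D eps Heps) as [del Hdel].
set (r := Rmin (del / 2) (rad / 2)).
assert (Hr : 0 < r < rad /\ r < del).
{ generalize (cond_pos del) (Rmin_l (del / 2) (rad / 2)) (Rmin_r (del / 2) (rad / 2)).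
  intros; assert (0 < r) by (apply Rmin_glb_lt; lra); unfold r in *; lra. }
assert (H1 := Hdel r ltac:(lra)).
rewrite Rplus_0_l, circle_mean_0, Rminus_0_r, (Rabs_pos_eq r) in H1 by lra.
specialize (H1 (proj2 Hr)).
assert (H2 := circle_mean_slope_diff (proj1 Hr)).
assert (H3 : Rabs (circle_mean f z rad / rad) <= PI * (4 * M / rad)).
{ unfold Rdiv; rewrite Rabs_mult, Rabs_inv, (Rabs_pos_eq rad) by lra.
  replace (PI * (4 * M * / rad)) with (2 * PI * (2 * M) * / rad) by ring.
  apply Rmult_le_compat_r; [left; now apply Rinv_0_lt_compat | apply circle_mean_le]. }
apply Rabs_def2 in H1; apply Rabs_le_between in H2; apply Rabs_le_between in H3.
apply Rabs_le; lra.
Qed.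

End Estimate.

(** [Cauchy_estimate_Re] for f and i f bounds Re f_x + Im f_y and Re f_y - Im f_x. Together with the
    two components of [dbar f], these determine all four real partial derivatives. *)
Lemma Cauchy_estimate (f : C -> C) (z : C) (rad M d : R) : smooth f -> 0 < rad ->
  (forall q, Cmod (q - z) <= 2 * rad -> Cmod (f q) <= M /\
    Cmod (dbar f q) <= d /\
    Cmod (dx (dbar f) q) <= d /\ Cmod (dy (dbar f) q) <= d) ->
  Cmod (dx f z) <= 4 * M / rad + 32 * d * rad + 2 * d /\
  Cmod (dy f z) <= 4 * M / rad + 32 * d * rad + 2 * d.
Proof.
intros Hf Hr H.
assert (Hi := smooth_scal Ci Hf).
assert (Ed : dbar (fun z => Ci * f z)%C = (fun z => Ci * dbar f z)%C).
{ assert (P := smooth_has_partials Hf); unfold dbar.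
  rewrite dx_scal, dy_scal by assumption.
  apply functional_extensionality; intros q; ring. }
assert (Hd := smooth_has_partials (smooth_dbar Hf)).
assert (H1 : Rabs (Re (dx f z) + Im (dy f z)) <= 4 * M / rad + 32 * d * rad).
{ apply Cauchy_estimate_Re; try assumption.
  - intros q Hq; apply H; lra.
  - intros q Hq; apply H; lra. }
assert (H2 : Rabs (Re (dx (fun z => Ci * f z)%C z) + Im (dy (fun z => Ci * f z)%C z))
  <= 4 * M / rad + 32 * d * rad).
{ apply Cauchy_estimate_Re; try assumption.
  - intros q Hq; rewrite Cmod_mult, Cmod_Ci, Rmult_1_l; apply H; lra.
  - intros q Hq; rewrite Ed, dx_scal, dy_scal, !Cmod_mult, !Cmod_Ci, !Rmult_1_l
      by assumption.
    apply H; lra. }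
rewrite dx_scal, dy_scal in H2 by now apply smooth_has_partials.
assert (H0 : Cmod (z - z) <= 2 * rad).
{ replace (z - z)%C with (RtoC 0) by ring; rewrite Cmod_0; lra. }
destruct (H z H0) as (_ & H3 & _).
assert (R3 := Rle_trans _ _ _ (re_le_Cmod _) H3).
assert (I3 := Rle_trans _ _ _ (Im_le_Cmod _) H3).
unfold dbar in R3, I3.
destruct (dx f z) as [x1 x2] eqn:Ex, (dy f z) as [y1 y2] eqn:Ey.
unfold Re, Im in *; simpl in *.
apply Rabs_le_between in H1; apply Rabs_le_between in H2.
apply Rabs_le_between in R3; apply Rabs_le_between in I3.
assert (T : forall c : C, Cmod c <= Rabs (fst c) + Rabs (snd c))
  by exact Cmod_le_Re_Im.
(* Each component is at most half of 4 M / rad + 32 d rad, plus d; the modulus is at most the sum of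
   two components. *)
split; (apply Rle_trans with (1 := T _)); simpl;
 unfold Rabs; repeat destruct Rcase_abs; lra.
Qed.

(** * Moderate nets of points and uniform bounds *)

Definition moderate_pt (x : net C) : Prop := moderate (K := C_AbsRing) x.

Lemma moderate_pt_represents (x : net C) :
  moderate_pt x -> exists p : Ctilde, represents p x.
Proof.
intros Hx; exists (class (@net_equiv C_AbsRing) Hx).
apply represents_self, net_equiv_is_equiv.
Qed.

(* If [P] failed on the balls of radius e^(-N) for arbitrarily small e, choosing
   a bad point in each of these balls would give a moderate net. *)
Lemma for_small_uniform (P : index -> C -> Prop) (N : nat) :
  (forall x, moderate_pt x -> for_small (fun e => P e (x e))) ->
  for_small (fun e => forall z, Cmod z <= / e ^ N -> P e z).
Proof.
intros H.
assert (W : forall e : index, exists w : C, Cmod w <= / e ^ N /\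
  (P e w -> forall z, Cmod z <= / e ^ N -> P e z)).
{ intros e; destruct (classic (exists w, Cmod w <= / e ^ N /\ ~ P e w))
    as [(w & Hw & F)|F].
  - now exists w.
  - exists (RtoC 0); split.
    + rewrite Cmod_0; left; apply Rinv_0_lt_compat, pow_lt, ival_gt0.
    + intros _ z Hz; apply NNPP; intros Q; apply F; now exists z. }
destruct (functional_choice _ W) as [x Hx].
assert (Mx : moderate_pt x).
{ exists N; apply for_small_imp with (2 := for_small_le Rlt_0_1).
  intros e _; apply Hx. }
apply for_small_imp with (2 := H x Mx); intros e; apply Hx.
Qed.

(* The hypotheses of the theorem on a representative; unlike those hypotheses,
   they are inherited by all partial derivatives of the net. *)
Record almost_entire_bounded (v : net (C -> C)) : Prop := {
  aeb_smooth : forall e, smooth (v e);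
  aeb_dbar : forall a b x, moderate_pt x ->
    negligible (K := C_AbsRing) (fun e => partial a b (dbar (v e)) (x e));
  aeb_bounded : exists k : nat, forall x, moderate_pt x ->
    for_small (fun e => Cmod (v e (x e)) <= / e ^ k)
}.

(** Numerical constants are absorbed by one extra power of e. *)
Lemma for_small_scal (c : R) (n : nat) : 0 < c ->
  for_small (fun e => c * e ^ S n <= e ^ n).
Proof.
intros Hc; apply for_small_imp with (2 := for_small_le (Rinv_0_lt_compat _ Hc)).
intros e He; simpl.
assert (0 < e ^ n) by apply pow_lt, ival_gt0.
assert (c * e <= 1).
{ apply Rmult_le_reg_l with (/ c); [now apply Rinv_0_lt_compat|].
  rewrite <- Rmult_assoc, Rinv_l; lra. }
nra.
Qed.

Lemma for_small_scal_inv (c : R) (n : nat) : 0 < c ->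
  for_small (fun e => c * / e ^ n <= / e ^ S n).
Proof.
intros Hc; apply for_small_imp with (2 := for_small_scal n Hc).
intros e He.
assert (0 < e ^ n) by apply pow_lt, ival_gt0.
assert (0 < e ^ S n) by apply pow_lt, ival_gt0.
apply Rmult_le_reg_r with (e ^ S n); [assumption|].
rewrite Rinv_l by lra.
apply Rmult_le_reg_r with (e ^ n); [assumption|].
replace (c * / e ^ n * e ^ S n * e ^ n) with (c * e ^ S n) by (field; lra); lra.
Qed.

Lemma Rinv_pow_index_le (e : index) (m n : nat) : (m <= n)%nat -> / e ^ m <= / e ^ n.
Proof.
intros H; apply Rinv_le_contravar; [apply pow_lt, ival_gt0 | now apply pow_index_le].
Qed.

(** * Negligibility of the derivatives *)

Lemma almost_entire_bounded_grad v x : almost_entire_bounded v -> moderate_pt x ->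
  negligible (K := C_AbsRing) (fun e => dx (v e) (x e)) /\
  negligible (K := C_AbsRing) (fun e => dy (v e) (x e)).
Proof.
intros [Hs Hd [k Hk]] [N Hx].
enough (H : forall m, for_small (fun e =>
  Cmod (dx (v e) (x e)) <= e ^ m /\ Cmod (dy (v e) (x e)) <= e ^ m)).
{ split; intros m; apply for_small_imp with (2 := H m); intros e He; apply He. }
intros m.
(* With radius e^(-j), M = e^(-k) and d = e^n, the terms of the Cauchy estimate are at most 4, 32
   and 2 times e^(m+1); their sum 38 e^(m+1) is below e^m for small e. *)
set (j := (k + S m)%nat); set (n := (j + S m)%nat).
(* The ball of radius e^(-L) about 0 contains the one of radius 2 e^(-j) about x, as 3 e^(-(N+j)) <=
   e^(-L) for small e. *)
set (L := S (N + j)).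
assert (U : for_small (fun e => forall z, Cmod z <= / e ^ L ->
  (Cmod (v e z) <= / e ^ k /\ Cmod (dbar (v e) z) <= e ^ n) /\
  (Cmod (dx (dbar (v e)) z) <= e ^ n /\ Cmod (dy (dbar (v e)) z) <= e ^ n))).
{ apply (@for_small_uniform (fun e z =>
    (Cmod (v e z) <= / e ^ k /\ Cmod (dbar (v e) z) <= e ^ n) /\
    (Cmod (dx (dbar (v e)) z) <= e ^ n /\ Cmod (dy (dbar (v e)) z) <= e ^ n))).
  intros y Hy; repeat apply for_small_and.
  - now apply Hk.
  - apply (Hd 0%nat 0%nat y Hy).
  - apply (Hd 1%nat 0%nat y Hy).
  - apply (Hd 0%nat 1%nat y Hy). }
assert (P3 : 0 < 3) by lra; assert (P38 : 0 < 38) by lra.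
apply for_small_imp with (2 := for_small_and (for_small_and U Hx)
  (for_small_and (for_small_scal_inv (N + j) P3) (for_small_scal m P38))).
intros e [[He Hxe] [E3 E38]]; change (abs (x e)) with (Cmod (x e)) in Hxe.
fold L in E3.
assert (E0 := ival_gt0 e).
assert (Pw : forall i, 0 < e ^ i) by (intros i; now apply pow_lt).
assert (I1 : / e ^ N <= / e ^ (N + j)) by (apply Rinv_pow_index_le; lia).
assert (I2 : / e ^ j <= / e ^ (N + j)) by (apply Rinv_pow_index_le; lia).
assert (Q : 4 * / e ^ k / (/ e ^ j) + 32 * e ^ n * / e ^ j + 2 * e ^ n <= e ^ m).
{ replace (4 * / e ^ k / (/ e ^ j)) with (4 * e ^ S m)
    by (unfold j; rewrite pow_add; field; split; apply Rgt_not_eq, Pw).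
  replace (32 * e ^ n * / e ^ j) with (32 * e ^ S m)
    by (unfold n; rewrite pow_add; field; apply Rgt_not_eq, Pw).
  assert (e ^ n <= e ^ S m) by (apply pow_index_le; lia); lra. }
destruct (@Cauchy_estimate (v e) (x e) (/ e ^ j) (/ e ^ k) (e ^ n)) as [C1 C2].
- apply Hs.
- apply Rinv_0_lt_compat, Pw.
- intros q Hq.
  assert (Hq' : Cmod q <= / e ^ L).
  { replace q with ((q - x e) + x e)%C by ring.
    apply Rle_trans with (1 := Cmod_triangle _ _); lra. }
  specialize (He q Hq'); tauto.
- lra.
Qed.

Lemma negligible_bounded (v : net (C -> C)) :
  (forall x, moderate_pt x -> negligible (K := C_AbsRing) (fun e => v e (x e))) ->
  exists k : nat, forall x, moderate_pt x ->
    for_small (fun e => Cmod (v e (x e)) <= / e ^ k).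
Proof.
intros H; exists 0%nat; intros x Hx.
apply for_small_imp with (2 := H x Hx 0%nat); intros e He.
simpl in *; now rewrite Rinv_1.
Qed.

Lemma dbar_dx f : smooth f -> dbar (dx f) = dx (dbar f).
Proof.
intros Hf; change (dx (dbar f)) with (partial 1 0 (dbar f)).
rewrite (partial_dbar 1 0 Hf), <- (partial_dx 0 1 Hf); reflexivity.
Qed.

Lemma dbar_dy f : smooth f -> dbar (dy f) = dy (dbar f).
Proof.
intros Hf; change (dy (dbar f)) with (partial 0 1 (dbar f)).
now rewrite (partial_dbar 0 1 Hf).
Qed.

(** [dbar] commutes with [dx]; boundedness of the derivative comes from its negligibility, which
    [almost_entire_bounded_grad] supplies. *)
Lemma almost_entire_bounded_dx v :
  almost_entire_bounded v -> almost_entire_bounded (fun e => dx (v e)).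
Proof.
intros Hv; assert (Hs := aeb_smooth Hv); split.
- intros e; now apply smooth_dx.
- intros a b x Hx; generalize (aeb_dbar Hv (S a) b Hx).
  apply negligible_le; intros e.
  rewrite dbar_dx, partial_dx by (try apply smooth_dbar; apply Hs); apply Rle_refl.
- apply (negligible_bounded (v := fun e => dx (v e))); intros x Hx; now apply almost_entire_bounded_grad.
Qed.

Lemma almost_entire_bounded_dy v :
  almost_entire_bounded v -> almost_entire_bounded (fun e => dy (v e)).
Proof.
intros Hv; assert (Hs := aeb_smooth Hv); split.
- intros e; now apply smooth_dy.
- intros a b x Hx; generalize (aeb_dbar Hv a (S b) Hx).
  apply negligible_le; intros e.
  rewrite dbar_dy, partial_dy by apply Hs; apply Rle_refl.
- apply (negligible_bounded (v := fun e => dy (v e))); intros x Hx; now apply almost_entire_bounded_grad.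
Qed.

Lemma almost_entire_bounded_partial a b v :
  almost_entire_bounded v -> almost_entire_bounded (fun e => partial a b (v e)).
Proof.
intros Hv; induction a as [|a IHa]; [induction b as [|b IHb]; [exact Hv|]|].
- exact (almost_entire_bounded_dy IHb).
- exact (almost_entire_bounded_dx IHa).
Qed.

(** Peel off the outermost derivative and apply the gradient lemma to the remaining partial
    derivative. *)
Lemma almost_entire_bounded_partial_negligible a b v x :
  (a + b > 0)%nat -> almost_entire_bounded v -> moderate_pt x ->
  negligible (K := C_AbsRing) (fun e => partial a b (v e) (x e)).
Proof.
intros Hab Hv Hx; destruct a as [|a]; [destruct b as [|b]; [lia|]|].
- exact (proj2 (almost_entire_bounded_grad (almost_entire_bounded_partial 0 b Hv) Hx)).
- exact (proj1 (almost_entire_bounded_grad (almost_entire_bounded_partial a b Hv) Hx)).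
Qed.

Lemma almost_entire_bounded_const v x : almost_entire_bounded v -> moderate_pt x ->
  negligible (K := C_AbsRing) (fun e => v e (x e) - v e (RtoC 0))%C.
Proof.
intros Hv [N Hx] m.
(* A gradient of size e^n over a distance e^(-N) changes v by at most 4 e^(m+1), which is below e^m
   for small e. *)
set (n := (N + S m)%nat).
assert (U : for_small (fun e => forall z, Cmod z <= / e ^ S N ->
  Cmod (dx (v e) z) <= e ^ n /\ Cmod (dy (v e) z) <= e ^ n)).
{ apply (@for_small_uniform (fun e z =>
    Cmod (dx (v e) z) <= e ^ n /\ Cmod (dy (v e) z) <= e ^ n)); intros y Hy.
  destruct (almost_entire_bounded_grad Hv Hy) as [H1 H2].
  apply for_small_and; [apply H1 | apply H2]. }
assert (P2 : 0 < 2) by lra; assert (P4 : 0 < 4) by lra.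
apply for_small_imp with (2 := for_small_and (for_small_and U Hx)
  (for_small_and (for_small_scal_inv N P2) (for_small_scal m P4))).
intros e [[He Hxe] [E2 E4]]; change (abs (x e)) with (Cmod (x e)) in Hxe.
assert (E : (x e - RtoC 0)%C = x e) by ring.
assert (P : 0 < e ^ N) by apply pow_lt, ival_gt0.
assert (Pn : 0 < e ^ n) by apply pow_lt, ival_gt0.
apply Rle_trans with (4 * e ^ n * Cmod (x e)).
- change (Cmod (v e (x e) - v e (RtoC 0)) <= 4 * e ^ n * Cmod (x e)).
  rewrite <- E at 2; apply lipschitz; [apply (aeb_smooth Hv)|].
  intros q; rewrite E; intros Hq; apply He.
  replace q with (q - RtoC 0)%C by ring; lra.
- apply Rle_trans with (2 := E4).
  replace (4 * e ^ S m) with (4 * e ^ n * / e ^ N)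
    by (unfold n; rewrite pow_add; field; lra).
  apply Rmult_le_compat_l; lra.
Qed.

(** * Passage to representatives and conclusion *)

(** The exponent must serve all points at once, so it is read off one fixed representative [s] of
    [K]. The representatives in [gle] vary with the point, but two changes of representative cost at
    most 1 each for small e, and e^(-k) + 2 <= 3 e^(-k) <= e^(-(k+1)). *)
Lemma bounded_representative (u : Gtilde Ctilde_full) (v : net (C -> C)) (K : Rtilde) :
  represents u v -> (forall z : Ctilde, gle (gabs (point_value u z I)) K) ->
  exists k : nat, forall x, moderate_pt x ->
    for_small (fun e => Cmod (v e (x e)) <= / e ^ k).
Proof.
intros uv HK.
assert (ER := net_equiv_is_equiv R_AbsRing).
destruct (represents_ex ER K) as [s Hs].
destruct (represents_dom Hs) as [k Hk].
exists (S k); intros x Hx.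
destruct (moderate_pt_represents Hx) as [p px].
destruct (HK p) as (y & y' & Hy & Hy' & L).
assert (V := point_valueE I uv px).
rewrite (classP (net_equiv_is_equiv C_AbsRing) V), gabsE in Hy.
assert (N1 := represents_equiv ER Hy
  (represents_self ER (moderate_abs (represents_dom V))) 0%nat).
assert (N2 := represents_equiv ER Hy' Hs 0%nat).
assert (P3 : 0 < 3) by lra.
apply for_small_imp with (2 := for_small_and (for_small_and L Hk)
  (for_small_and (for_small_and N1 N2) (for_small_scal_inv k P3))).
intros e [[L1 L2] [[L3 L4] L5]].
change (Rabs (y e - Cmod (v e (x e))) <= 1) in L3.
change (Rabs (y' e - s e) <= 1) in L4.
change (Rabs (s e) <= / e ^ k) in L2.
apply Rabs_le_between in L2; apply Rabs_le_between in L3; apply Rabs_le_between in L4.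
assert (H1 : / e ^ 0 <= / e ^ k) by (apply Rinv_pow_index_le; lia).
simpl in H1; rewrite Rinv_1 in H1; lra.
Qed.

Lemma holomorphic_dbar (u : Gtilde Ctilde_full) (v : net (C -> C)) :
  represents u v -> holomorphic u ->
  forall a b x, moderate_pt x ->
    negligible (K := C_AbsRing) (fun e => partial a b (dbar (v e)) (x e)).
Proof.
intros uv Hu a b x Hx; assert (Hv := represents_dom uv).
assert (E := @fun_equiv_is_equiv Ctilde_full).
unfold holomorphic in Hu.
rewrite (classP E uv), gdbarE in Hu; unfold Czero in Hu; rewrite gconstE in Hu.
apply class_eq in Hu; [|exact E].
destruct (moderate_pt_represents Hx) as [p px].
generalize (proj2 Hu a b p x I px); apply negligible_le; intros e.
replace (fun z : C => (dbar (v e) z - RtoC 0)%C) with (dbar (v e));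
  [apply Rle_refl|].
apply functional_extensionality; intros z; ring.
Qed.

Theorem proposition4p14 (u : Gtilde Ctilde_full) :
  holomorphic u ->
  (exists K : Rtilde, forall z : Ctilde, gle (gabs (point_value u z I)) K) ->
  exists c : Ctilde, u = gconst Ctilde_full c.
Proof.
intros Hu [K HK].
assert (E := @fun_equiv_is_equiv Ctilde_full).
destruct (represents_ex E u) as [v uv].
assert (Hv := represents_dom uv).
assert (B : almost_entire_bounded v).
{ split; [apply Hv | exact (holomorphic_dbar uv Hu) | exact (bounded_representative uv HK)]. }
assert (M0 : moderate_pt (fun _ => RtoC 0)) by exact (moderate_const (RtoC 0 : C_AbsRing)).
destruct (moderate_pt_represents M0) as [p px].
assert (Hc : moderate (K := C_AbsRing) (fun e => v e (RtoC 0)))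
  by exact (proj2 Hv 0%nat 0%nat p _ I px).
(* The constant is the value of u at the origin. *)
exists (class (@net_equiv C_AbsRing) Hc).
rewrite (classP E uv), gconstE; apply class_eq; [exact E|].
split; [intros e; apply smooth_minus; [apply Hv | apply smooth_const]|].
intros a b q x _ qx; assert (Mx : moderate_pt x) by exact (represents_dom qx).
(* Order zero compares u with its value at the origin; in positive order the derivative of the
   constant vanishes. *)
destruct (Nat.eq_dec (a + b) 0) as [Z|Z].
- replace a with 0%nat by lia; replace b with 0%nat by lia.
  exact (almost_entire_bounded_const B Mx).
- assert (Z' : (a + b > 0)%nat) by lia.
  generalize (almost_entire_bounded_partial_negligible Z' B Mx).
  apply negligible_le; intros e.
  rewrite partial_minus by (apply Hv || apply smooth_const).
  destruct (partial_const a b (v e (RtoC 0))) as [(_ & -> & ->)| ->]; [now elim Z|].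
  right; f_equal.
  change (partial a b (v e) (x e) - RtoC 0 = partial a b (v e) (x e))%C; ring.
Qed.
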